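(* Let $a=d=\tfrac14$ and $b=e\neq0$. Then $\mathcal L=\mathcal L_{a,b,d,e}$ is a real Lie algebra of dimension $9$ with basis \begin{align*} v_1&=be^{bt}x\,\partial_x+be^{bt}y\,\partial_y+e^{bt}\partial_t+2be^{bt}\big(b(x+y)-\tfrac12\big)u\,\partial_u,\\ v_2&=-be^{-bt}x\,\partial_x-be^{-bt}y\,\partial_y+e^{-bt}\partial_t,\qquad v_3=\partial_t-\tfrac b2u\,\partial_u,\\ v_4&=\sqrt{xy}\,\partial_x-\sqrt{xy}\,\partial_y,\\ v_5&=\sqrt x\,e^{bt/2}\partial_x+2b\sqrt x\,e^{bt/2}u\,\partial_u,\qquad v_6=\sqrt x\,e^{-bt/2}\partial_x,\\ v_7&=\sqrt y\,e^{bt/2}\partial_y+2b\sqrt y\,e^{bt/2}u\,\partial_u,\qquad v_8=\sqrt y\,e^{-bt/2}\partial_y,\qquad v_9=u\,\partial_u, \end{align*} where $e^{(\cdot)}$ denotes the exponential function. The span $J$ of $v_4,\dots,v_9$ is a $6$-dimensional ideal of $\mathcal L$. The linear map sending the classes $\bar v_1\mapsto -bE$, $\bar v_2\mapsto bF$, $\bar v_3\mapsto\tfrac b2H$ is an isomorphism of Lie algebras $\mathcal L/J\cong\mathfrak{sl}_2$, and $\mathcal L\cong\mathfrak{sl}_2\ltimes J$ (semidirect product with ideal $J$).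
   Context: All Lie algebras are real. For real constants $a,b,d,e$ consider the PDE $$\Delta:=(a-bx)u_x+(d-ey)u_y+\tfrac x2u_{xx}+\tfrac y2u_{yy}+u_t=0$$ for $u=u(x,y,t)$, $x,y>0$, $t\in\mathbb R$. An infinitesimal symmetry of the PDE is a smooth vector field $v=\xi\partial_x+\gamma\partial_y+\tau\partial_t+\phi\partial_u$ on $\{(x,y,t,u):x>0,y>0,t\in\mathbb R,u\in\mathbb R\}$, with $\xi,\gamma,\tau,\phi$ functions of $(x,y,t,u)$, whose second prolongation $\mathrm{pr}^{(2)}v$ satisfies $\mathrm{pr}^{(2)}v(\Delta)=0$ at all points of the second jet space where $\Delta=0$. $\mathcal V_{a,b,d,e}$ is the Lie algebra of all infinitesimal symmetries, under the Lie bracket of vector fields. For every $v\in\mathcal V_{a,b,d,e}$ the coefficient $\phi$ is affine in $u$: $\phi=\lambda_v(x,y,t)u+\mu_v(x,y,t)$. Set $\mathcal L_{a,b,d,e}=\{v\in\mathcal V_{a,b,d,e}:\mu_v=0\}$. $\{E,F,H\}$ is the canonical basis of $\mathfrak{sl}_2$: $[E,F]=H$, $[H,E]=2E$, $[H,F]=-2F$. *)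

(* Defs.v *)
From HB Require Import structures.
From mathcomp Require Import all_boot all_order all_algebra.
From mathcomp Require Import generic_quotient ring_quotient.
From mathcomp Require Import all_classical all_reals all_analysis.
Set Implicit Arguments.
Unset Strict Implicit.
Unset Printing Implicit Defensive.
Import Order.TTheory GRing.Theory Num.Theory.
Import numFieldNormedType.Exports.
Local Open Scope classical_set_scope.
Local Open Scope ring_scope.

(** * Lie algebras *)

HB.mixin Record Lmodule_isLie (F : fieldType) L of GRing.Lmodule F L := {
  lie : L -> L -> L;
  lie_linearl : forall z (k : F) (x y : L),
    lie (k *: x + y) z = k *: lie x z + lie y z;
  lie_linearr : forall z (k : F) (x y : L),
    lie z (k *: x + y) = k *: lie z x + lie z y;
  lie_xx : forall x, lie x x = 0;
  lie_jacobi : forall x y z,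
    lie x (lie y z) + lie y (lie z x) + lie z (lie x y) = 0
}.

#[short(type="lieAlgType")]
HB.structure Definition LieAlgebra (F : fieldType) :=
  {L of Lmodule_isLie F L & GRing.Lmodule F L}.

Section LieTheory.
Context (F : fieldType) (L : lieAlgType F).
Implicit Types x y z : L.

Lemma lieDl x y z : lie (x + y) z = lie x z + lie y z.
Proof. by rewrite -[x]scale1r lie_linearl !scale1r. Qed.

Lemma lieDr x y z : lie z (x + y) = lie z x + lie z y.
Proof. by rewrite -[x]scale1r lie_linearr !scale1r. Qed.

Lemma lieBr x y z : lie z (x - y) = lie z x - lie z y.
Proof. by rewrite addrC -scaleN1r lie_linearr scaleN1r addrC. Qed.

Lemma lieC x y : lie x y = - lie y x.
Proof.
have := lie_xx (x + y); rewrite lieDl !lieDr !lie_xx add0r addr0 => /eqP.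
by rewrite addr_eq0 => /eqP.
Qed.

End LieTheory.

(* [S] is a Lie algebra for the linear structure of [V] and the bracket [br].
   The bracket is only required to be a Lie bracket on [S]: the bracket of
   vector fields below is defined on arbitrary functions, where it is junk
   unless the functions are differentiable. *)
Record is_lie_algebra (F : fieldType) (V : lmodType F) (br : V -> V -> V)
    (S : set V) : Prop := IsLieAlgebra {
  isl_0 : S 0;
  isl_lin : forall (k : F) v w, S v -> S w -> S (k *: v + w);
  isl_br : forall v w, S v -> S w -> S (br v w);
  isl_linl : forall z (k : F) v w, S z -> S v -> S w ->
    br (k *: v + w) z = k *: br v z + br w z;
  isl_linr : forall z (k : F) v w, S z -> S v -> S w ->
    br z (k *: v + w) = k *: br z v + br z w;
  isl_xx : forall v, S v -> br v v = 0;
  isl_jacobi : forall x y z, S x -> S y -> S z ->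
    br x (br y z) + br y (br z x) + br z (br x y) = 0
}.

Section SubLie.
Context (F : fieldType) (V : lmodType F) (br : V -> V -> V) (S : set V).
Context (H : is_lie_algebra br S).

Definition sub_pred of is_lie_algebra br S : pred V := fun v => v \in S.

Record sub_lie := SubLie { sub_val :> V; sub_valP : sub_pred H sub_val }.

HB.instance Definition _ := [isSub for sub_val].
HB.instance Definition _ := [Choice of sub_lie by <:].

Lemma sub_pred_closed : subsemimod_closed (sub_pred H).
Proof.
split; first split.
- by rewrite inE; exact: isl_0 H.
- move=> x y; rewrite !inE => hx hy.
  by rewrite -[x]scale1r; exact: isl_lin H _ _ _ hx hy.
- move=> k x; rewrite !inE => hx; rewrite -[_ *: _]addr0.
  by apply: (isl_lin H) => //; exact: isl_0 H.
Qed.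

HB.instance Definition _ :=
  GRing.SubChoice_isSubLmodule.Build F V (sub_pred H) sub_lie sub_pred_closed.

Lemma sub_mem (x : sub_lie) : S (val x).
Proof. by have := sub_valP x; rewrite inE. Qed.

Definition sub_mk (v : V) (hv : S v) : sub_lie := SubLie (mem_set hv : sub_pred H v).

Definition sub_br (x y : sub_lie) : sub_lie :=
  sub_mk (isl_br H (sub_mem x) (sub_mem y)).

Fact sub_br_linl z (k : F) (x y : sub_lie) :
  sub_br (k *: x + y) z = k *: sub_br x z + sub_br y z.
Proof. apply: val_inj => /=; exact: isl_linl H _ _ _ _ (sub_mem _) (sub_mem _) (sub_mem _). Qed.

Fact sub_br_linr z (k : F) (x y : sub_lie) :
  sub_br z (k *: x + y) = k *: sub_br z x + sub_br z y.
Proof. apply: val_inj => /=; exact: isl_linr H _ _ _ _ (sub_mem _) (sub_mem _) (sub_mem _). Qed.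

Fact sub_br_xx x : sub_br x x = 0.
Proof. apply: val_inj => /=; exact: isl_xx H _ (sub_mem _). Qed.

Fact sub_br_jacobi x y z :
  sub_br x (sub_br y z) + sub_br y (sub_br z x) + sub_br z (sub_br x y) = 0.
Proof. apply: val_inj => /=; exact: isl_jacobi H _ _ _ (sub_mem _) (sub_mem _) (sub_mem _). Qed.

HB.instance Definition _ := Lmodule_isLie.Build F sub_lie
  sub_br_linl sub_br_linr sub_br_xx sub_br_jacobi.

End SubLie.

Record is_lie_ideal (F : fieldType) (L : lieAlgType F) (J : set L) : Prop :=
  IsLieIdeal {
  ideal_0 : J 0;
  ideal_lin : forall (k : F) x y, J x -> J y -> J (k *: x + y);
  ideal_br : forall x y, J y -> J (lie x y)
}.

Lemma ideal_is_lie_algebra (F : fieldType) (L : lieAlgType F) (J : set L) :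
  is_lie_ideal J -> is_lie_algebra (@lie F L) J.
Proof.
move=> HJ; split=> *; by [exact: ideal_0 HJ | exact: (ideal_lin HJ) |
  exact: (ideal_br HJ) | exact: lie_linearl | exact: lie_linearr |
  exact: lie_xx | exact: lie_jacobi].
Qed.

Definition ideal_lie (F : fieldType) (L : lieAlgType F) (J : set L)
  (HJ : is_lie_ideal J) : lieAlgType F := sub_lie (ideal_is_lie_algebra HJ).

Section QuotLie.
Context (F : fieldType) (L : lieAlgType F) (J : set L) (HJ : is_lie_ideal J).
Local Open Scope quotient_scope.

Definition ideal_pred of is_lie_ideal J : pred L := fun x => x \in J.

Fact ideal_pred_closed : zmod_closed (ideal_pred HJ).
Proof.
split; first by rewrite inE; exact: ideal_0 HJ.
move=> x y; rewrite !inE => hx hy; rewrite addrC -scaleN1r.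
exact: (ideal_lin HJ).
Qed.

HB.instance Definition _ := GRing.isZmodClosed.Build L (ideal_pred HJ)
  ideal_pred_closed.

Definition ideal_closed : zmodClosed L :=
  GRing.ZmodClosed.clone L (ideal_pred HJ) _.
Definition quot_lie := Quotient.quot ideal_closed.

HB.instance Definition _ := GRing.Zmodule.on quot_lie.

Definition lie_pi (x : L) : quot_lie := \pi_quot_lie x.

Lemma lie_pi_eq x y : lie_pi x = lie_pi y <-> J (x - y).
Proof.
split.
- by move/eqP; rewrite -Quotient.idealrBE inE.
- by move=> h; apply/eqP; rewrite -Quotient.idealrBE inE.
Qed.

Lemma lie_pi_surj (q : quot_lie) : exists x, lie_pi x = q.
Proof. by exists (repr q); rewrite /lie_pi reprK. Qed.

Lemma lie_piD x y : lie_pi (x + y) = lie_pi x + lie_pi y.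
Proof. exact: (raddfD \pi_(Quotient.quot ideal_closed)). Qed.

Definition quot_scale (k : F) (q : quot_lie) : quot_lie := lie_pi (k *: repr q).
Definition quot_br (p q : quot_lie) : quot_lie := lie_pi (lie (repr p) (repr q)).

Lemma repr_pi x : J (repr (lie_pi x) - x).
Proof. by apply/lie_pi_eq; rewrite /lie_pi reprK. Qed.

Lemma quot_scale_pi k x : quot_scale k (lie_pi x) = lie_pi (k *: x).
Proof.
apply/lie_pi_eq; rewrite -scalerBr -[_ *: _]addr0.
by apply: (ideal_lin HJ); [exact: repr_pi | exact: ideal_0 HJ].
Qed.

Lemma lie_pi_lie x y : quot_br (lie_pi x) (lie_pi y) = lie_pi (lie x y).
Proof.
apply/lie_pi_eq.
have hN z : J z -> J (- z).
  by move=> hz; rewrite -scaleN1r -[_ *: _]addr0; apply: (ideal_lin HJ) => //;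
     exact: ideal_0 HJ.
have hD u w : J u -> J w -> J (u + w).
  by move=> hu hw; rewrite -[u]scale1r; exact: (ideal_lin HJ).
set x' := repr _; set y' := repr _.
have hx : J (x' - x) by exact: repr_pi.
have hy : J (y' - y) by exact: repr_pi.
have -> : lie x' y' - lie x y = lie x' (y' - y) - lie y (x' - x).
  by rewrite !lieBr opprB (lieC y x) (lieC y x') opprK (addrC (- _)) addrA subrK.
by apply: (hD); [exact: (ideal_br HJ) | apply: hN; exact: (ideal_br HJ)].
Qed.

Fact quot_scaleA a b q : quot_scale a (quot_scale b q) = quot_scale (a * b) q.
Proof. by case: (lie_pi_surj q) => x <-; rewrite !quot_scale_pi scalerA. Qed.

Fact quot_scale1 : left_id 1 quot_scale.
Proof. by move=> q; case: (lie_pi_surj q) => x <-; rewrite quot_scale_pi scale1r. Qed.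

Fact quot_scaleDr : right_distributive quot_scale +%R.
Proof.
move=> k p q; case: (lie_pi_surj p) => x <-; case: (lie_pi_surj q) => y <-.
by rewrite -lie_piD !quot_scale_pi scalerDr lie_piD.
Qed.

Fact quot_scaleDl q : {morph quot_scale^~ q : a b / a + b}.
Proof.
move=> a b; case: (lie_pi_surj q) => x <-.
by rewrite !quot_scale_pi scalerDl lie_piD.
Qed.

HB.instance Definition _ := GRing.Zmodule_isLmodule.Build F quot_lie
  quot_scaleA quot_scale1 quot_scaleDr quot_scaleDl.

Lemma lie_pi_linear : linear lie_pi.
Proof. by move=> k x y; rewrite lie_piD -quot_scale_pi. Qed.

HB.instance Definition _ := GRing.isLinear.Build F L quot_lie _ lie_pi lie_pi_linear.

Fact quot_br_linl z (k : F) (x y : quot_lie) :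
  quot_br (k *: x + y) z = k *: quot_br x z + quot_br y z.
Proof.
case: (lie_pi_surj x) => {}x <-; case: (lie_pi_surj y) => {}y <-.
case: (lie_pi_surj z) => {}z <-.
by rewrite -linearP !lie_pi_lie -linearP lie_linearl.
Qed.

Fact quot_br_linr z (k : F) (x y : quot_lie) :
  quot_br z (k *: x + y) = k *: quot_br z x + quot_br z y.
Proof.
case: (lie_pi_surj x) => {}x <-; case: (lie_pi_surj y) => {}y <-.
case: (lie_pi_surj z) => {}z <-.
by rewrite -linearP !lie_pi_lie -linearP lie_linearr.
Qed.

Fact quot_br_xx x : quot_br x x = 0.
Proof. by case: (lie_pi_surj x) => {}x <-; rewrite lie_pi_lie lie_xx linear0. Qed.

Fact quot_br_jacobi x y z :
  quot_br x (quot_br y z) + quot_br y (quot_br z x) + quot_br z (quot_br x y) = 0.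
Proof.
case: (lie_pi_surj x) => {}x <-; case: (lie_pi_surj y) => {}y <-.
case: (lie_pi_surj z) => {}z <-.
by rewrite !lie_pi_lie -!linearD lie_jacobi linear0.
Qed.

HB.instance Definition _ := Lmodule_isLie.Build F quot_lie
  quot_br_linl quot_br_linr quot_br_xx quot_br_jacobi.

End QuotLie.

Section SemiDirect.
Context (F : fieldType) (S J : lieAlgType F).

(* [theta] is a homomorphism of Lie algebras from [S] to the derivations of [J]. *)
Record is_lie_action (theta : S -> J -> J) : Prop := IsLieAction {
  act_linl : forall (k : F) s s' x,
    theta (k *: s + s') x = k *: theta s x + theta s' x;
  act_linr : forall s (k : F) x y,
    theta s (k *: x + y) = k *: theta s x + theta s y;
  act_der : forall s x y,
    theta s (lie x y) = lie (theta s x) y + lie x (theta s y);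
  act_hom : forall s s' x,
    theta (lie s s') x = theta s (theta s' x) - theta s' (theta s x)
}.

Context (theta : S -> J -> J) (Ht : is_lie_action theta).

Definition semidirect of is_lie_action theta : Type := (S * J)%type.
HB.instance Definition _ := GRing.Lmodule.copy (semidirect Ht) (S * J)%type.

Definition semidirect_br (p q : semidirect Ht) : semidirect Ht :=
  (lie p.1 q.1, lie p.2 q.2 + theta p.1 q.2 - theta q.1 p.2).

Fact semidirect_br_linl z (k : F) (x y : semidirect Ht) :
  semidirect_br (k *: x + y) z = k *: semidirect_br x z + semidirect_br y z.
Proof.
case: x y z => [s x] [t y] [r z]; congr pair; rewrite /= ?lie_linearl //.
rewrite (act_linl Ht) (act_linr Ht) !scalerDr scalerN opprD.
by rewrite [X in X + _ = _]addrACA [LHS]addrACA.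
Qed.

Fact semidirect_br_linr z (k : F) (x y : semidirect Ht) :
  semidirect_br z (k *: x + y) = k *: semidirect_br z x + semidirect_br z y.
Proof.
case: x y z => [s x] [t y] [r z]; congr pair; rewrite /= ?lie_linearr //.
rewrite (act_linl Ht) (act_linr Ht) !scalerDr scalerN opprD.
by rewrite [X in X + _ = _]addrACA [LHS]addrACA.
Qed.

Fact semidirect_br_xx x : semidirect_br x x = 0.
Proof.
by case: x => s x; congr pair; rewrite /= lie_xx // add0r subrr.
Qed.

Fact semidirect_br_jacobi x y z :
  semidirect_br x (semidirect_br y z) + semidirect_br y (semidirect_br z x)
    + semidirect_br z (semidirect_br x y) = 0.
Proof.
case: x y z => [s x] [t y] [r z]; congr pair; rewrite /=; first exact: lie_jacobi.
have thB a u v : theta a (u - v) = theta a u - theta a v.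
  by rewrite addrC -scaleN1r (act_linr Ht) scaleN1r addrC.
have thD a u v : theta a (u + v) = theta a u + theta a v.
  by rewrite -[u]scale1r (act_linr Ht) !scale1r.
rewrite !lieBr !lieDr !thB !thD !(act_der Ht) !(act_hom Ht) !opprB.
rewrite (lieC (theta s y) z) (lieC (theta t z) x) (lieC (theta r x) y) !addrA.
rewrite [LHS](ACl ((1*10*19)*(2*13)*(3*23)*(4*20)*(5*12)*(6*27)*(7*17)*(8*25)*(9*15)*(11*22)*(14*21)*(16*26)*(18*24)))%AC /=.
by rewrite !subrr !addNr lie_jacobi !addr0.
Qed.

HB.instance Definition _ := Lmodule_isLie.Build F (semidirect Ht)
  semidirect_br_linl semidirect_br_linr semidirect_br_xx semidirect_br_jacobi.

End SemiDirect.

Definition lie_iso (F : fieldType) (L M : lieAlgType F) (f : L -> M) : Prop :=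
  [/\ linear f, (forall x y, f (lie x y) = lie (f x) (f y)) & bijective f].

Definition lin_span (F : fieldType) (V : lmodType F) (I : finType) (e : I -> V)
  : set V := [set v | exists c : I -> F, v = \sum_i c i *: e i].

Definition is_basis (F : fieldType) (V : lmodType F) (I : finType) (e : I -> V)
  : Prop :=
  (forall c : I -> F, \sum_i c i *: e i = 0 -> forall i, c i = 0)
  /\ lin_span e = setT.

Definition has_dim (F : fieldType) (V : lmodType F) (n : nat) : Prop :=
  exists e : 'I_n -> V, is_basis e.

Section Sl2.
Context (F : fieldType).

Definition mx_br (A B : 'M[F]_2) : 'M[F]_2 := A *m B - B *m A.
Definition sl2_set : set 'M[F]_2 := [set A | \tr A = 0].

Lemma sl2_is_lie_algebra : is_lie_algebra mx_br sl2_set.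
Proof.
rewrite /sl2_set /mx_br; split => /=.
- by rewrite mxtrace0.
- by move=> k v w hv hw; rewrite mxtraceD mxtraceZ hv hw mulr0 addr0.
- by move=> v w _ _; rewrite linearB /= mxtrace_mulC subrr.
- move=> z k v w _ _ _.
  by rewrite mulmxDl mulmxDr -scalemxAl -scalemxAr scalerBr opprD addrACA.
- move=> z k v w _ _ _.
  by rewrite mulmxDl mulmxDr -scalemxAl -scalemxAr scalerBr opprD addrACA.
- by move=> v _; rewrite subrr.
move=> x y z _ _ _; rewrite !mulmxBr !mulmxBl !mulmxA !opprB !addrA.
by rewrite [LHS](ACl ((1*12)*(2*7)*(3*10)*(4*5)*(6*11)*(8*9)))%AC /= ?subrr ?addNr ?addr0.
Qed.

Definition sl2 : lieAlgType F := sub_lie sl2_is_lie_algebra.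

Definition sl2E_mx : 'M[F]_2 := delta_mx 0 1.
Definition sl2F_mx : 'M[F]_2 := delta_mx 1 0.
Definition sl2H_mx : 'M[F]_2 := delta_mx 0 0 - delta_mx 1 1.

Fact sl2E_subproof : sl2_set sl2E_mx.
Proof. by rewrite /sl2_set /= /mxtrace !big_ord_recl big_ord0 !mxE /= !addr0. Qed.
Fact sl2F_subproof : sl2_set sl2F_mx.
Proof. by rewrite /sl2_set /= /mxtrace !big_ord_recl big_ord0 !mxE /= !addr0. Qed.
Fact sl2H_subproof : sl2_set sl2H_mx.
Proof.
by rewrite /sl2_set /= /mxtrace !big_ord_recl big_ord0 !mxE /= subr0 sub0r addr0 subrr.
Qed.

Definition sl2E : sl2 := sub_mk sl2_is_lie_algebra sl2E_subproof.
Definition sl2F : sl2 := sub_mk sl2_is_lie_algebra sl2F_subproof.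
Definition sl2H : sl2 := sub_mk sl2_is_lie_algebra sl2H_subproof.

End Sl2.

(** * Vector fields, jets and infinitesimal symmetries *)

Section Symmetries.
Context (R : realType).

(* A point of the base space is the row (x, y, t, u). *)
Notation pt := 'rV[R]_4.

(* The index in (x, y, t, u) of the i-th independent variable, i in {x, y, t}. *)
Definition indep (i : 'I_3) : 'I_4 := lift ord_max i.
Definition ix : 'I_3 := @Ordinal 3 0 isT.
Definition iy : 'I_3 := @Ordinal 3 1 isT.
Definition it : 'I_3 := @Ordinal 3 2 isT.

Definition ptx (p : pt) : R := p 0 (indep ix).
Definition pty (p : pt) : R := p 0 (indep iy).
Definition ptt (p : pt) : R := p 0 (indep it).
Definition ptu (p : pt) : R := p 0 ord_max.

Definition Omega : set pt := [set p | 0 < ptx p /\ 0 < pty p].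

(* A vector field on Omega is represented by its row of coefficients
   (xi, gamma, tau, phi), extended by zero outside Omega; Leibniz equality of
   such functions is equality of vector fields on Omega. *)
Notation vfield := (pt -> pt).

Definition vf_br (v w : vfield) : vfield :=
  fun p => 'D_(v p) w p - 'D_(w p) v p.

Definition mk_vf (xi gamma tau phi : R -> R -> R -> R -> R) : vfield :=
  fun p =>
    let x := ptx p in let y := pty p in let t := ptt p in let u := ptu p in
    if (0 < x) && (0 < y) then
      \row_(i < 4) [:: xi x y t u; gamma x y t u; tau x y t u; phi x y t u]`_i
    else 0.

Definition partial (i : 'I_4) (f : pt -> pt) : pt -> pt :=
  fun p => 'D_(delta_mx 0 i) f p.

(* C^infinity on the open set Omega: every iterated partial derivative exists
   and is Frechet differentiable at every point. *)
Definition smooth_on_Omega (f : pt -> pt) : Prop :=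
  forall (s : seq 'I_4) (p : pt),
    Omega p -> differentiable (foldr partial f s) p.

(* Second jet space over the base space: the coordinates are the point
   (x, y, t, u), the row of the u_i and the matrix of the u_ij; only the points
   with a symmetric matrix (u_ij) are jets. *)
Notation jet1 := (pt * 'rV[R]_3)%type.
Notation jet2 := (pt * 'rV[R]_3 * 'M[R]_3)%type.

Definition is_jet2 (z : jet2) : Prop := Omega z.1.1 /\ z.2^T = z.2.

(* Total derivatives D_k of a function on the base space and on the first jet
   space: D_k = d/dx_k + u_k d/du + sum_j u_jk d/du_j. *)
Definition total0 (k : 'I_3) (f : pt -> R) : jet1 -> R :=
  fun z => 'D_(delta_mx 0 (indep k)) f z.1 + z.2 0 k * 'D_(delta_mx 0 ord_max) f z.1.

Definition total1 (k : 'I_3) (f : jet1 -> R) : jet2 -> R :=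
  fun z =>
    'D_((delta_mx 0 (indep k), 0) : jet1) f z.1
    + z.1.2 0 k * 'D_((delta_mx 0 ord_max, 0) : jet1) f z.1
    + \sum_j z.2 j k * 'D_((0, delta_mx 0 j) : jet1) f z.1.

Definition vf_xi (v : vfield) (i : 'I_3) : pt -> R := fun p => v p 0 (indep i).
Definition vf_phi (v : vfield) : pt -> R := fun p => v p 0 ord_max.

(* Coefficients of the second prolongation:
   phi^i = D_i phi - sum_j u_j D_i xi_j,
   phi^ik = D_k phi^i - sum_j u_ij D_k xi_j. *)
Definition prol1 (v : vfield) (i : 'I_3) : jet1 -> R :=
  fun z => total0 i (vf_phi v) z - \sum_j z.2 0 j * total0 i (vf_xi v j) z.

Definition prol2 (v : vfield) (i k : 'I_3) : jet2 -> R :=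
  fun z => total1 k (prol1 v i) z - \sum_j z.2 i j * total0 k (vf_xi v j) z.1.

Definition prolongation (v : vfield) (z : jet2) : jet2 :=
  (v z.1.1, \row_i prol1 v i z.1, \matrix_(i, k) prol2 v i k z).

(* A vector field acts on a function as the derivative along its value; the
   prolongation is tangent to the symmetric matrices, as prol2 is symmetric at
   jets for smooth v. *)
Definition pr2 (v : vfield) (G : jet2 -> R) : jet2 -> R :=
  fun z => 'D_(prolongation v z) G z.

Definition Delta (a b d e : R) (z : jet2) : R :=
  let x := ptx z.1.1 in let y := pty z.1.1 in
  (a - b * x) * z.1.2 0 ix + (d - e * y) * z.1.2 0 iy
  + x / 2 * z.2 ix ix + y / 2 * z.2 iy iy + z.1.2 0 it.

Definition symmetries (a b d e : R) : set vfield :=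
  [set v | [/\ forall p, ~ Omega p -> v p = 0,
               smooth_on_Omega v
             & forall z, is_jet2 z -> Delta a b d e z = 0 ->
                 pr2 v (Delta a b d e) z = 0]].

(* The symmetries with phi = lambda(x, y, t) u + mu(x, y, t) and mu = 0. *)
Definition symmetries0 (a b d e : R) : set vfield :=
  [set v | symmetries a b d e v /\
    exists lam : R -> R -> R -> R, forall p, Omega p ->
      vf_phi v p = lam (ptx p) (pty p) (ptt p) * ptu p].

Definition gens (b : R) : seq vfield := [::
  mk_vf (fun x y t u => b * expR (b * t) * x)
        (fun x y t u => b * expR (b * t) * y)
        (fun x y t u => expR (b * t))
        (fun x y t u => 2 * b * expR (b * t) * (b * (x + y) - 2^-1) * u);
  mk_vf (fun x y t u => - (b * expR (- (b * t)) * x))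
        (fun x y t u => - (b * expR (- (b * t)) * y))
        (fun x y t u => expR (- (b * t)))
        (fun x y t u => 0);
  mk_vf (fun x y t u => 0)
        (fun x y t u => 0)
        (fun x y t u => 1)
        (fun x y t u => - (b / 2 * u));
  mk_vf (fun x y t u => Num.sqrt (x * y))
        (fun x y t u => - Num.sqrt (x * y))
        (fun x y t u => 0)
        (fun x y t u => 0);
  mk_vf (fun x y t u => Num.sqrt x * expR (b * t / 2))
        (fun x y t u => 0)
        (fun x y t u => 0)
        (fun x y t u => 2 * b * Num.sqrt x * expR (b * t / 2) * u);
  mk_vf (fun x y t u => Num.sqrt x * expR (- (b * t / 2)))
        (fun x y t u => 0)
        (fun x y t u => 0)
        (fun x y t u => 0);
  mk_vf (fun x y t u => 0)
        (fun x y t u => Num.sqrt y * expR (b * t / 2))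
        (fun x y t u => 0)
        (fun x y t u => 2 * b * Num.sqrt y * expR (b * t / 2) * u);
  mk_vf (fun x y t u => 0)
        (fun x y t u => Num.sqrt y * expR (- (b * t / 2)))
        (fun x y t u => 0)
        (fun x y t u => 0);
  mk_vf (fun x y t u => 0)
        (fun x y t u => 0)
        (fun x y t u => 0)
        (fun x y t u => u)].

End Symmetries.

(* Main.v *)
Require Import Defs.
From HB Require Import structures.
From mathcomp Require Import all_boot all_order all_algebra.
From mathcomp Require Import all_classical all_reals all_analysis.
From mathcomp Require Import ring lra.
Set Implicit Arguments.
Unset Strict Implicit.
Unset Printing Implicit Defensive.
Import Order.TTheory GRing.Theory Num.Theory.
Import numFieldNormedType.Exports.
Local Open Scope classical_set_scope.
Local Open Scope ring_scope.

(* With x = s^2 and y = r^2 the equation becomes the backward equation of an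
   isotropic two-dimensional Ornstein-Uhlenbeck process; a = d = 1/4 is the case
   in which the terms u_s / s and u_r / r cancel. The coefficients of u_xt, u_yt
   and u_xy in pr^(2) v (Delta) force tau = tau(t) and make xi, gamma independent
   of u; those of u_xx, u_yy and u_xy then give
     xi = tau' s^2 + kap r s + alp s,   gamma = tau' r^2 - kap r s + bet r
   with kap, alp, bet functions of t. The coefficients of u_x and u_y determine
   the gradient of lambda = phi / u; its integrability gives kap' = 0 and
     lambda = P (s^2 + r^2) + Q s + S r + f,
     P = tau'' + b tau',   Q = 2 alp' + b alp,   S = 2 bet' + b bet,
   and the coefficient of u gives P' = b P, Q' = (b/2) Q, S' = (b/2) S and
   f' = - P / 2. Solving these equations leaves nine constants, the coefficients
   on v_1, ..., v_9. The brackets of the v_i then identify the algebra with R^9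
   carrying explicit structure constants; v_1, v_2, v_3 span a subalgebra
   isomorphic to sl_2 and complementary to J. *)

(** * Directional derivatives *)

(** The condition [smooth_on_Omega] concerns partial derivatives of every order. The nine fields are
    therefore written in a small syntax closed under differentiation, in which smoothness and the
    derivatives entering the prolongation are computed by recursion. They are treated together as
    one field [gen b c], linear in nine coefficients. With s, r and exp (b t / 2) as unknowns, its
    being a symmetry and its brackets are rational identities. Once the range of [gen] is known to
    be all of [symmetries0], the Lie axioms become polynomial identities in the coefficients. For an
    unknown symmetry the determining equations are solved along coordinate lines at u = 1, each
    reduced to a function of one variable with zero derivative. The list in [pd v j s] records the
    order of differentiation, the head being applied last; where two orders meet, each is computed
    from the explicit dependence on one of the variables. *)

Section PointwiseDerive.
Context (R : realType) (V : normedModType R).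
Implicit Types (f g : V -> R) (p v : V).

Lemma is_derive_add f g p v a b : is_derive p v f a -> is_derive p v g b ->
  is_derive p v (fun q => f q + g q) (a + b).
Proof. exact: is_deriveD. Qed.

Lemma is_derive_sub f g p v a b : is_derive p v f a -> is_derive p v g b ->
  is_derive p v (fun q => f q - g q) (a - b).
Proof. exact: is_deriveB. Qed.

Lemma is_derive_mul f g p v a b : is_derive p v f a -> is_derive p v g b ->
  is_derive p v (fun q => f q * g q) (a * g p + f p * b).
Proof.
move=> hf hg; have h := is_deriveM hf hg; apply: is_derive_eq h _.
by rewrite addrC [_ *: _]mulrC.
Qed.

Lemma is_derive_const c p v : is_derive p v (fun=> c : R) 0.
Proof. exact: is_derive_cst. Qed.

Lemma is_derive_bigsum n (f : 'I_n -> V -> R) p v (a : 'I_n -> R) :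
  (forall i, is_derive p v (f i) (a i)) ->
  is_derive p v (fun q => \sum_(i < n) f i q) (\sum_(i < n) a i).
Proof.
move=> h; rewrite (_ : (fun q => _) = \sum_(i < n) f i); first exact: is_derive_sum.
by apply/funext => q; rewrite fct_sumE.
Qed.

(** Both sides are limits of the same difference quotient. This transfers the one-variable chain
    rule to directional derivatives, and makes composition with a projection of a product immediate,
    since projections send lines to lines. *)
Lemma is_derive_lineP f p v a :
  is_derive p v f a <-> is_derive (0 : R) 1 (fun h : R => f (h *: v + p)) a.
Proof.
have E : 'D_1 (fun h : R => f (h *: v + p)) (0 : R) = 'D_v f p.
  rewrite /derive; set g1 := fun h => h^-1 *: _; set g2 := fun h => h^-1 *: _.
  suff -> : g1 = g2 by [].
  rewrite funeqE /g1 /g2 => h /=.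
  by rewrite scale0r add0r addr0 [_ *: 1]mulr1.
split=> -[h <-]; split; rewrite ?E //; first exact: (derivable1P _ _ _).1.
exact: (derivable1P _ _ _).2.
Qed.

Lemma is_derive_outer (k : R -> R) f p v a b :
  is_derive (f p) 1 k b -> is_derive p v f a ->
  is_derive p v (fun q => k (f q)) (b * a).
Proof.
move=> hk /is_derive_lineP hf; apply/is_derive_lineP.
apply: (@is_derive1_comp _ k (fun h : R => f (h *: v + p))) => //.
by rewrite scale0r add0r.
Qed.

End PointwiseDerive.

(** The first-order expansion of [f] at [p] is one of [g], and such an expansion determines the
    differential. The fields are cut off to zero outside [Omega], so they agree with smooth
    expressions only near points of it. *)
Lemma near_eq_differentiable (R : realType) (V W : normedModType R) (f g : V -> W) p :
  (\forall q \near p, g q = f q) -> differentiable f p -> differentiable g p.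
Proof.
move=> fg df; have dfc := diff_continuous df.
have E : g \o shift p = cst (g p) + 'd f p +o_ 0 id.
  have /eqaddoP H := diff_locally df; apply/eqaddoP => e e0.
  have fg0 : \forall h \near (0 : V), g (h + p) = f (h + p).
    move: fg; rewrite (near_shift 0 p) => fg; apply: filterS fg => h /=.
    by rewrite subr0.
  move: (H e e0); apply: filterS2 fg0 => h fgh.
  by rewrite -![(_ + _ : _ -> _) _]/(_ + _) /= fgh /cst (nbhs_singleton fg).
apply/diff_locallyP; have -> : 'd g p = 'd f p :> (V -> W) by exact: diff_unique.
by [].
Unshelve. all: by end_near. Qed.

(** * Functions stable under partial derivatives *)

Lemma is_deriveE (R : realType) (V W : normedModType R) (f : V -> W) p v a :
  is_derive p v f a -> 'D_v f p = a.
Proof. by case. Qed.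

Section Coordinates.
Context (R : realType).
Notation pt := 'rV[R]_4.
Implicit Types (p v : pt).

Variant dir := dX | dY | dT | dU.

Definition idx (d : dir) : 'I_4 :=
  match d with dX => indep ix | dY => indep iy | dT => indep it | dU => ord_max end.

Definition dir_of (i : 'I_4) : dir :=
  match val i with 0%N => dX | 1%N => dY | 2%N => dT | _ => dU end.

Lemma idxK : cancel idx dir_of. Proof. by case. Qed.

Lemma dir_ofK : cancel dir_of idx.
Proof. by case=> -[|[|[|[|n]]]] hn //; apply: val_inj. Qed.

Lemma sum_dir (F : 'I_4 -> R) :
  \sum_i F i = F (idx dX) + F (idx dY) + F (idx dT) + F (idx dU).
Proof.
rewrite !big_ord_recr big_ord0 /= add0r.
by congr (F _ + F _ + F _ + F _); apply: val_inj.
Qed.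

Lemma sum_indep (F : 'I_3 -> R) : \sum_i F i = F ix + F iy + F it.
Proof.
rewrite !big_ord_recr big_ord0 /= add0r.
by congr (F _ + F _ + F _); apply: val_inj.
Qed.

Lemma indep_ind (P : 'I_3 -> Prop) : P ix -> P iy -> P it -> forall j, P j.
Proof.
by move=> hx hy ht [[|[|[|//]]] hj]; [move: hx|move: hy|move: ht];
  congr P; exact: val_inj.
Qed.

Lemma coord_is_derive n (q w : 'rV[R]_n.+1) i :
  is_derive q w (fun q : 'rV[R]_n.+1 => q 0 i) (w 0 i).
Proof.
apply/is_derive_lineP.
rewrite (_ : (fun h : R => _) = (fun h => h * w 0 i + q 0 i)); last first.
  by apply/funext => h; rewrite !mxE.
by apply: is_derive_eq; rewrite scaler0 add0r addr0 [_ *: _]mulr1.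
Qed.

Lemma comp_is_derive (f : pt -> pt) p v i : differentiable f p ->
  is_derive p v (fun q => f q 0 i) (('D_v f p) 0 i).
Proof.
move=> df; have df' := diff_derivable df (v := v).
by split; [exact: (derivable_mxP _ _ _).1 df' 0 i | rewrite derive_mx // mxE].
Qed.

Lemma open_Omega : open (@Omega R).
Proof.
have op i : open [set p : pt | 0 < p 0 i].
  apply: (@open_comp _ _ (fun p : pt => p 0 i) [set x | 0 < x]).
    by move=> p _; exact: coord_continuous.
  exact: open_gt.
exact: openI (op _) (op _).
Qed.

Lemma near_Omega p : Omega p -> \forall q \near p, Omega q.
Proof. by move=> Op; apply: open_nbhs_nbhs; split=> //; exact: open_Omega. Qed.

End Coordinates.

Section Expr.
Context (R : realType).
Notation pt := 'rV[R]_4.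
Implicit Types (p v : pt).

(** The inverse square roots are atoms because the derivative of sqrt x is half of 1 / sqrt x, whose
    own derivative is - 1/2 times its cube; [Ex k] stands for exp (k t). *)
Inductive expr :=
  | Cst of R | Var of dir | Sqx | Sqy | Iqx | Iqy | Ex of R
  | Add of expr & expr | Mul of expr & expr.

Fixpoint eval (e : expr) p : R :=
  match e with
  | Cst c => c
  | Var d => p 0 (idx d)
  | Sqx => Num.sqrt (p 0 (idx dX))
  | Sqy => Num.sqrt (p 0 (idx dY))
  | Iqx => (Num.sqrt (p 0 (idx dX)))^-1
  | Iqy => (Num.sqrt (p 0 (idx dY)))^-1
  | Ex k => expR (k * p 0 (idx dT))
  | Add e f => eval e p + eval f p
  | Mul e f => eval e p * eval f p
  end.

Fixpoint dexpr (d : dir) (e : expr) : expr :=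
  match e with
  | Cst c => Cst 0
  | Var d' => match d, d' with
              | dX, dX | dY, dY | dT, dT | dU, dU => Cst 1
              | _, _ => Cst 0 end
  | Sqx => if d is dX then Mul (Cst 2^-1) Iqx else Cst 0
  | Sqy => if d is dY then Mul (Cst 2^-1) Iqy else Cst 0
  | Iqx => if d is dX then Mul (Cst (- 2^-1)) (Mul Iqx (Mul Iqx Iqx)) else Cst 0
  | Iqy => if d is dY then Mul (Cst (- 2^-1)) (Mul Iqy (Mul Iqy Iqy)) else Cst 0
  | Ex k => if d is dT then Mul (Cst k) (Ex k) else Cst 0
  | Add e f => Add (dexpr d e) (dexpr d f)
  | Mul e f => Add (Mul (dexpr d e) f) (Mul e (dexpr d f))
  end.

Lemma coord_delta d d' : (delta_mx 0 (idx d) : pt) 0 (idx d') =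
  (match d, d' with
              | dX, dX | dY, dY | dT, dT | dU, dU => 1
              | _, _ => 0 end).
Proof. by rewrite mxE; case: d; case: d'. Qed.

Lemma is_derive_invsqrt (x : R) : 0 < x ->
  is_derive x 1 (fun x => (Num.sqrt x)^-1) (- 2^-1 * ((Num.sqrt x)^-1) ^+ 3).
Proof.
move=> x0; have s0 : Num.sqrt x != 0 by rewrite sqrtr_eq0 -ltNge.
apply: is_derive_eq; first by apply: is_deriveV => //; exact: is_derive1_sqrt.
rewrite -[LHS]/(- Num.sqrt x ^- 2 * (2 * Num.sqrt x)^-1).
by move: (Num.sqrt x) s0 => s s0; field.
Qed.

Lemma eval_is_derive d e p : Omega p ->
  is_derive p (delta_mx 0 (idx d)) (eval e) (eval (dexpr d e) p).
Proof.
move=> [x0 y0].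
elim: e => [c|d'|||||k|e he f hf|e he f hf] /=.
- exact: is_derive_const.
- apply: is_derive_eq; first exact: coord_is_derive.
  by rewrite coord_delta; case: d; case: d'.
- apply: is_derive_eq.
    by apply: is_derive_outer; [exact: is_derive1_sqrt | exact: coord_is_derive].
  by rewrite (coord_delta d dX) invfM; case: d; rewrite /= ?mulr1 ?mulr0.
- apply: is_derive_eq.
    by apply: is_derive_outer; [exact: is_derive1_sqrt | exact: coord_is_derive].
  by rewrite (coord_delta d dY) invfM; case: d; rewrite /= ?mulr1 ?mulr0.
- apply: is_derive_eq.
    by apply: (@is_derive_outer _ _ (fun x => (Num.sqrt x)^-1));
      [exact: is_derive_invsqrt | exact: coord_is_derive].
  by rewrite (coord_delta d dX); case: d; rewrite /= ?mulr1 ?mulr0.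
- apply: is_derive_eq.
    by apply: (@is_derive_outer _ _ (fun x => (Num.sqrt x)^-1));
      [exact: is_derive_invsqrt | exact: coord_is_derive].
  by rewrite (coord_delta d dY); case: d; rewrite /= ?mulr1 ?mulr0.
- apply: is_derive_eq.
    apply: (@is_derive_outer _ _ expR (fun p => k * p 0 (idx dT))).
    by apply: is_derive_mul; exact: coord_is_derive.
  rewrite (coord_delta d dT); case: d; rewrite /= mul0r add0r ?mulr1 ?mulr0 //.
  by rewrite mulrC.
- exact: is_derive_add.
- exact: is_derive_mul.
Qed.

Lemma eval_differentiable e p : Omega p -> differentiable (eval e) p.
Proof.
move=> [x0 y0].
have dc i : differentiable (fun p : pt => p 0 i) p by exact: differentiable_coord.
have outer (k : R -> R) i : derivable k (p 0 i) 1 ->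
    differentiable (fun p : pt => k (p 0 i)) p.
  move=> hk; apply: (@differentiable_comp _ _ _ _ (fun p : pt => p 0 i) k) => //.
  exact/derivable1_diffP.
elim: e => [c|d'|||||k|e he f hf|e he f hf] /=.
- exact: differentiable_cst.
- exact: dc.
- by apply: outer; have [] := is_derive1_sqrt x0.
- by apply: outer; have [] := is_derive1_sqrt y0.
- by apply: (outer (fun x => (Num.sqrt x)^-1)); have [] := is_derive_invsqrt x0.
- by apply: (outer (fun x => (Num.sqrt x)^-1)); have [] := is_derive_invsqrt y0.
- apply: (outer (fun t => expR (k * t))).
  have [//] : is_derive (p 0 (idx dT)) 1 (fun t => expR (k * t))
    (expR (k * p 0 (idx dT)) * (k * 1)).
  apply: (@is_derive_outer _ _ expR (fun t => k * t)).
- exact: differentiableD.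
- exact: differentiableM.
Qed.

Definition vf (E : dir -> expr) : pt -> pt := fun p =>
  if (0 < ptx p) && (0 < pty p) then \row_i eval (E (dir_of i)) p else 0.

Lemma vfE E p : Omega p -> vf E p = \row_i eval (E (dir_of i)) p.
Proof. by rewrite /vf => -[-> ->]. Qed.

Lemma vf_out E p : ~ Omega p -> vf E p = 0.
Proof. by rewrite /vf => h; case: andP. Qed.

Lemma vf_differentiable E p : Omega p -> differentiable (vf E) p.
Proof.
move=> Op.
pose f q : pt := \sum_i eval (E (dir_of i)) q *: delta_mx 0 i.
apply: (@near_eq_differentiable _ _ _ f).
  apply: filterS (near_Omega Op) => q Oq; rewrite vfE // [LHS]row_sum_delta.
  by apply: eq_bigr => i _; rewrite mxE.
rewrite (_ : f =
  \sum_i (fun q => eval (E (dir_of i)) q *: (delta_mx 0 i : pt))); last first.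
  by apply/funext => q; rewrite fct_sumE.
apply: differentiable_sum => i.
by apply: differentiableZl; exact: eval_differentiable.
Qed.

(** A derivative sees only values near [p], and [Omega] is open, so at each step the inner
    derivative may be replaced by its syntactic form. *)
Lemma partial_vf E s p : Omega p ->
  foldr (@partial R) (vf E) (map idx s) p = vf (fun d => foldr dexpr (E d) s) p.
Proof.
elim: s p => //= d s IH p Op.
rewrite /partial (@near_eq_derive _ _ _ _ (vf (fun d => foldr dexpr (E d) s))); last first.
  by apply: filterS (near_Omega Op) => q Oq; rewrite IH.
rewrite derive_mx; last by apply: diff_derivable; exact: vf_differentiable.
apply/rowP => i; rewrite vfE // !mxE.
rewrite (@near_eq_derive _ _ _ _ (eval (foldr dexpr (E (dir_of i)) s))); last first.
  by apply: filterS (near_Omega Op) => q Oq; rewrite vfE // mxE.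
by rewrite (is_deriveE (eval_is_derive d _ Op)).
Qed.

Lemma vf_smooth E : smooth_on_Omega (vf E).
Proof.
move=> s p Op; rewrite -[s](mapK dir_ofK); move: (map dir_of s) => {}s.
apply: (@near_eq_differentiable _ _ _ (vf (fun d => foldr dexpr (E d) s))).
  by apply: filterS (near_Omega Op) => q Oq; rewrite partial_vf.
exact: vf_differentiable.
Qed.

End Expr.

Arguments Var {R}. Arguments Sqx {R}. Arguments Sqy {R}. Arguments Iqx {R}. Arguments Iqy {R}.
Arguments dexpr {R}.

(** * Second prolongation *)

(* Locked, so that [ring] and [lra] do not unfold derivatives when comparing
   atoms. *)
HB.lock Definition pd (R : realType) (v : 'rV[R]_4 -> 'rV[R]_4) (j : 'I_4)
  (s : seq 'I_4) (p : 'rV[R]_4) : R := foldr (@partial R) v s p 0 j.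

Section Prolongation.
Context (R : realType).
Notation pt := 'rV[R]_4.
Notation jet1 := (pt * 'rV[R]_3)%type.
Notation jet2 := (pt * 'rV[R]_3 * 'M[R]_3)%type.
Context (v : pt -> pt) (sv : smooth_on_Omega v).

Local Notation pd := (pd v).

Lemma pd0E j p : v p 0 j = pd j [::] p.
Proof. by rewrite pd.unlock. Qed.

Lemma pd_is_derive j s (k : 'I_4) p : Omega p ->
  is_derive p (delta_mx 0 k) (pd j s) (pd j (k :: s) p).
Proof. by move=> Op; rewrite pd.unlock; apply: comp_is_derive; exact: sv. Qed.

Lemma is_derive_fst (U V : normedModType R) (f : U -> R) (z w : U * V) a :
  is_derive z.1 w.1 f a -> is_derive z w (fun z => f z.1) a.
Proof. by move=> /is_derive_lineP h; apply/is_derive_lineP. Qed.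

Lemma is_derive_snd (U V : normedModType R) (f : V -> R) (z w : U * V) a :
  is_derive z.2 w.2 f a -> is_derive z w (fun z => f z.2) a.
Proof. by move=> /is_derive_lineP h; apply/is_derive_lineP. Qed.

(* The partial derivative, with respect to the variables in s, of the
   coefficient phi^i of the first prolongation. *)
Definition dprol1 (s : seq 'I_4) (i : 'I_3) (z : jet1) : R :=
  pd ord_max (rcons s (indep i)) z.1 + z.2 0 i * pd ord_max (rcons s ord_max) z.1
  - \sum_j z.2 0 j * (pd (indep j) (rcons s (indep i)) z.1
                        + z.2 0 i * pd (indep j) (rcons s ord_max) z.1).

Lemma prol1E i (z : jet1) : Omega z.1 -> prol1 v i z = dprol1 [::] i z.
Proof.
move=> Oz; have E j k : 'D_(delta_mx 0 k) (fun p => v p 0 j) z.1 = pd j [:: k] z.1.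
  by rewrite -(is_deriveE (pd_is_derive j [::] k Oz)) pd.unlock.
by rewrite /prol1 /total0 /vf_phi /vf_xi !E; under eq_bigr do rewrite !E.
Qed.

Lemma dprol1_base s i (m : 'I_4) (z : jet1) : Omega z.1 ->
  is_derive z (delta_mx 0 m, 0) (dprol1 s i) (dprol1 (m :: s) i z).
Proof.
move=> Oz.
have q j : is_derive z (delta_mx 0 m, 0) (fun z : jet1 => z.2 0 j) 0.
  have := @is_derive_snd _ _ (fun q : 'rV[R]_3 => q 0 j) z (delta_mx 0 m, 0) _
    (coord_is_derive z.2 0 j).
  by rewrite mxE.
have F j s' : is_derive z (delta_mx 0 m, 0) (fun z : jet1 => pd j s' z.1) (pd j (m :: s') z.1).
  by apply: (@is_derive_fst _ _ (pd j s')); exact: pd_is_derive.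
have H := is_derive_sub
  (is_derive_add (F ord_max (rcons s (indep i))) (is_derive_mul (q i) (F ord_max (rcons s ord_max))))
  (is_derive_bigsum (fun j => is_derive_mul (q j)
    (is_derive_add (F (indep j) (rcons s (indep i)))
                   (is_derive_mul (q i) (F (indep j) (rcons s ord_max)))))).
apply: is_derive_eq H _.
rewrite mul0r add0r /dprol1 /=; congr (_ + _ - _); apply: eq_bigr => j _.
by rewrite !mul0r !add0r.
Qed.

(** phi^i is quadratic in the u_j: the product of u_i with the sum of the u_j d xi_j / du
    contributes once through u_k in the sum, and once more through the factor u_i when i = k. *)
Lemma dprol1_fiber i (k : 'I_3) (z : jet1) : Omega z.1 ->
  is_derive z (0, delta_mx 0 k) (dprol1 [::] i)
   ((i == k)%:R * pd ord_max [:: ord_max] z.1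
    - (pd (indep k) [:: indep i] z.1 + z.2 0 i * pd (indep k) [:: ord_max] z.1)
    - (i == k)%:R * \sum_j z.2 0 j * pd (indep j) [:: ord_max] z.1).
Proof.
move=> Oz.
have q j : is_derive z (0, delta_mx 0 k) (fun z : jet1 => z.2 0 j) (j == k)%:R.
  have := @is_derive_snd _ _ (fun q : 'rV[R]_3 => q 0 j) z (0, delta_mx 0 k) _
    (coord_is_derive z.2 (delta_mx 0 k) j).
  by rewrite mxE.
have F j s' : is_derive z (0, delta_mx 0 k) (fun z : jet1 => pd j s' z.1) 0.
  by apply: (@is_derive_fst _ _ (pd j s')); exact: is_derive0.
have H := is_derive_sub
  (is_derive_add (F ord_max (rcons [::] (indep i))) (is_derive_mul (q i) (F ord_max (rcons [::] ord_max))))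
  (is_derive_bigsum (fun j => is_derive_mul (q j)
    (is_derive_add (F (indep j) (rcons [::] (indep i)))
                   (is_derive_mul (q i) (F (indep j) (rcons [::] ord_max)))))).
apply: is_derive_eq H _.
rewrite add0r mulr0 addr0 -addrA; congr (_ + _).
rewrite -opprD; congr (- _); rewrite mulr_sumr.
rewrite [X in X + _](_ : _ = \sum_j (j == k)%:R *
  (pd (indep j) [:: indep i] z.1 + z.2 0 i * pd (indep j) [:: ord_max] z.1)); last first.
  rewrite (bigD1 k) //= eqxx mul1r big1 ?addr0 // => j /negbTE ->.
  by rewrite mul0r.
rewrite -big_split; apply: eq_bigr => j _ /=.
by rewrite add0r addr0 (mulrCA (z.2 0 j)).
Qed.

Definition prol2_expr (i k : 'I_3) (z : jet2) : R :=
  dprol1 [:: indep k] i z.1 + z.1.2 0 k * dprol1 [:: ord_max] i z.1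
  + \sum_j z.2 j k * ((i == j)%:R * pd ord_max [:: ord_max] z.1.1
    - (pd (indep j) [:: indep i] z.1.1 + z.1.2 0 i * pd (indep j) [:: ord_max] z.1.1)
    - (i == j)%:R * \sum_l z.1.2 0 l * pd (indep l) [:: ord_max] z.1.1)
  - \sum_j z.2 i j * (pd (indep j) [:: indep k] z.1.1
                        + z.1.2 0 k * pd (indep j) [:: ord_max] z.1.1).

Lemma prol2E i k (z : jet2) : Omega z.1.1 -> prol2 v i k z = prol2_expr i k z.
Proof.
move=> Oz.
have E j m : 'D_(delta_mx 0 m) (fun p => v p 0 j) z.1.1 = pd j [:: m] z.1.1.
  by rewrite -(is_deriveE (pd_is_derive j [::] m Oz)) pd.unlock.
(* [prol2] differentiates [prol1], and the closed form is available over [Omega] only; agreement on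
   a neighbourhood is what lets the derivative pass to it. *)
have N : \forall y \near z.1, prol1 v i y = dprol1 [::] i y.
  have : \forall y \near z.1, Omega y.1.
    by apply: (@cvg_fst _ _ (nbhs z.1.1) (nbhs z.1.2)); exact: near_Omega.
  by apply: filterS => y Oy; exact: prol1E.
rewrite /prol2 /total1 /total0 /vf_xi !(near_eq_derive _ N).
rewrite !(is_deriveE (dprol1_base _ _ _ Oz)).
rewrite /prol2_expr; congr (_ + _ - _).
  apply: eq_bigr => j _; rewrite (near_eq_derive _ N).
  by rewrite (is_deriveE (dprol1_fiber _ _ Oz)).
by apply: eq_bigr => j _; rewrite !E.
Qed.

Lemma pr2_DeltaE (a b d e : R) (z : jet2) : Omega z.1.1 ->
  let q i := z.1.2 0 i in
  let x := ptx z.1.1 in let y := pty z.1.1 in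
  pr2 v (Delta a b d e) z =
    - b * v z.1.1 0 (indep ix) * q ix + (a - b * x) * dprol1 [::] ix z.1
    - e * v z.1.1 0 (indep iy) * q iy + (d - e * y) * dprol1 [::] iy z.1
    + v z.1.1 0 (indep ix) / 2 * z.2 ix ix + x / 2 * prol2_expr ix ix z
    + v z.1.1 0 (indep iy) / 2 * z.2 iy iy + y / 2 * prol2_expr iy iy z
    + dprol1 [::] it z.1.
Proof.
move=> Oz q x y.
set w := prolongation v z.
have X i : is_derive z w (fun z : jet2 => z.1.1 0 i) (v z.1.1 0 i).
  apply: (@is_derive_fst _ _ (fun z : jet1 => z.1 0 i)).
  by apply: (@is_derive_fst _ _ (fun z : pt => z 0 i)); exact: coord_is_derive.
have Q i : is_derive z w (fun z : jet2 => z.1.2 0 i) (dprol1 [::] i z.1).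
  apply: (@is_derive_fst _ _ (fun z : jet1 => z.2 0 i)).
  apply: (@is_derive_snd _ _ (fun z : 'rV[R]_3 => z 0 i)).
  by apply: is_derive_eq; [exact: coord_is_derive | rewrite mxE prol1E].
have M i j : is_derive z w (fun z : jet2 => z.2 i j) (prol2_expr i j z).
  apply: (@is_derive_snd _ _ (fun z : 'M[R]_3 => z i j)).
  apply/is_derive_lineP.
  rewrite (_ : (fun h : R => _) = (fun h => h * w.2 i j + z.2 i j)); last first.
    by apply/funext => h; rewrite !mxE.
  apply: is_derive_eq; rewrite scaler0 add0r addr0 [_ *: _]mulr1.
  by rewrite mxE prol2E.
have C c : is_derive z w (fun=> c) 0 := is_derive_const _ _ _.
rewrite /pr2 -/w.
have H : is_derive z w (Delta a b d e) (
    (0 - (0 * x + b * v z.1.1 0 (indep ix))) * q ix + (a - b * x) * dprol1 [::] ix z.1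
    + ((0 - (0 * y + e * v z.1.1 0 (indep iy))) * q iy + (d - e * y) * dprol1 [::] iy z.1)
    + ((v z.1.1 0 (indep ix) / 2 + x * 0) * z.2 ix ix + x / 2 * prol2_expr ix ix z)
    + ((v z.1.1 0 (indep iy) / 2 + y * 0) * z.2 iy iy + y / 2 * prol2_expr iy iy z)
    + dprol1 [::] it z.1).
  exact: is_derive_add (is_derive_add (is_derive_add (is_derive_add
    (is_derive_mul (is_derive_sub (C a) (is_derive_mul (C b) (X _))) (Q ix))
    (is_derive_mul (is_derive_sub (C d) (is_derive_mul (C e) (X _))) (Q iy)))
    (is_derive_mul (is_derive_mul (X _) (C 2^-1)) (M ix ix)))
    (is_derive_mul (is_derive_mul (X _) (C 2^-1)) (M iy iy))) (Q it).
rewrite (is_deriveE H).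
move: (dprol1 _ _ _) (dprol1 _ _ _) (dprol1 _ _ _) (prol2_expr _ _ _) (prol2_expr _ _ _).
move: (v _ _ _) (v _ _ _) (z.2 _ _) (z.2 _ _) (q _) (q _).
by move: (x) (y) => {H C M Q X w q x y Oz} *; ring.
Qed.

End Prolongation.

(** * Prolongation of projectable fields *)

Section Determining.
Context (R : realType).
Notation pt := 'rV[R]_4.
Notation jet2 := (pt * 'rV[R]_3 * 'M[R]_3)%type.
Context (v : pt -> pt) (sv : smooth_on_Omega v).

Local Notation X := (indep ix).
Local Notation Y := (indep iy).
Local Notation T := (indep it).
Local Notation U := (ord_max : 'I_4).

(** The usual projectability (tau a function of t; xi and gamma functions of x, y, t) with phi
    affine in u, expressed by the derivatives of order at most two at a single point that enter the
    prolongation. *)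
Definition projectable_at (p : pt) : Prop :=
  [/\ forall j k, pd v (indep j) [:: U] p = 0 /\
        pd v (indep j) [:: U; indep k] p = 0 /\
        pd v (indep j) [:: indep k; U] p = 0 /\ pd v (indep j) [:: U; U] p = 0,
      pd v U [:: U; U] p = 0,
      pd v T [:: X] p = 0 /\ pd v T [:: Y] p = 0
    & pd v T [:: X; X] p = 0 /\ pd v T [:: Y; Y] p = 0].

(** The vanishing derivatives are the coefficients of all terms of degree two or three in the u_i,
    of the products of some u_i with some u_jk, and of u_xt and u_yt. What remains is affine in the
    jet coordinates; it serves both to check the generators and to read off the determining
    equations. *)
Lemma pr2_projectable (a b d e : R) (z : jet2) : Omega z.1.1 -> z.2^T = z.2 ->
  projectable_at z.1.1 ->
  let q i := z.1.2 0 i in let m i j := z.2 i j in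
  let P j s := pd v j s z.1.1 in
  let x := ptx z.1.1 in let y := pty z.1.1 in
  pr2 v (Delta a b d e) z =
    - b * P X [::] * q ix
    + (a - b * x) * (P U [:: X] + q ix * P U [:: U] - q ix * P X [:: X] - q iy * P Y [:: X])
    - e * P Y [::] * q iy
    + (d - e * y) * (P U [:: Y] + q iy * P U [:: U] - q ix * P X [:: Y] - q iy * P Y [:: Y])
    + P X [::] / 2 * m ix ix
    + x / 2 * (P U [:: X; X] + q ix * (P U [:: X; U] + P U [:: U; X])
        - q ix * P X [:: X; X] - q iy * P Y [:: X; X]
        + m ix ix * (P U [:: U] - 2 * P X [:: X]) - 2 * m ix iy * P Y [:: X])
    + P Y [::] / 2 * m iy iy
    + y / 2 * (P U [:: Y; Y] + q iy * (P U [:: Y; U] + P U [:: U; Y])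
        - q ix * P X [:: Y; Y] - q iy * P Y [:: Y; Y]
        + m iy iy * (P U [:: U] - 2 * P Y [:: Y]) - 2 * m ix iy * P X [:: Y])
    + P U [:: T] + q it * P U [:: U] - q ix * P X [:: T] - q iy * P Y [:: T]
    - q it * P T [:: T].
Proof.
move=> Oz sz [H HU [Tx Ty] [Txx Tyy]] q m P x y.
rewrite pr2_DeltaE // /prol2_expr /dprol1 /= !sum_indep !pd0E.
have H0 j : pd v (indep j) [:: U] z.1.1 = 0 by have [] := H j j.
have H1 j k : pd v (indep j) [:: U; indep k] z.1.1 = 0 by have [_ []] := H j k.
have H2 j k : pd v (indep j) [:: indep k; U] z.1.1 = 0 by have [_ [_ []]] := H j k.
have H3 j : pd v (indep j) [:: U; U] z.1.1 = 0 by have [_ [_ []]] := H j j.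
have S i j : z.2 i j = z.2 j i by rewrite -{1}sz mxE.
rewrite (S iy ix) (S it ix) (S it iy).
rewrite !H0 !H1 !H2 !H3 HU Tx Ty Txx Tyy.
have d1 i : (i == i :> 'I_3)%:R = 1 :> R by rewrite eqxx.
have d0 : ((ix == iy)%:R = 0 :> R) * ((ix == it)%:R = 0 :> R)
  * ((iy == ix)%:R = 0 :> R) * ((iy == it)%:R = 0 :> R) by [].
rewrite !d1 !d0 /P /q /m /x /y.
ring.
Qed.

End Determining.

(** * The nine-parameter family of symmetries *)

Section Generators.
Context (R : realType) (b : R).
Notation pt := 'rV[R]_4.
Notation jet2 := (pt * 'rV[R]_3 * 'M[R]_3)%type.

Definition cf (c : 'rV[R]_9) (n : nat) : R := c 0 (inord n).

Definition term (c : 'rV[R]_9) (n : nat) (r : R) (e : expr R) : expr R :=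
  Mul (Cst (cf c n * r)) e.

Definition gexpr (c : 'rV[R]_9) (d : dir) : expr R :=
  match d with
  | dX => Add (Mul (Add (term c 0 b (Ex b)) (term c 1 (- b) (Ex (- b)))) (Var dX))
            (Mul Sqx (Add (term c 3 1 Sqy)
                          (Add (term c 4 1 (Ex (b / 2))) (term c 5 1 (Ex (- (b / 2)))))))
  | dY => Add (Mul (Add (term c 0 b (Ex b)) (term c 1 (- b) (Ex (- b)))) (Var dY))
            (Mul Sqy (Add (term c 3 (-1) Sqx)
                          (Add (term c 6 1 (Ex (b / 2))) (term c 7 1 (Ex (- (b / 2)))))))
  | dT => Add (Add (term c 0 1 (Ex b)) (term c 1 1 (Ex (- b)))) (Cst (cf c 2))
  | dU => Mul (Var dU)
      (Add (Mul (term c 0 (2 * b) (Ex b))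
                (Add (Mul (Cst b) (Add (Var dX) (Var dY))) (Cst (- 2^-1))))
           (Add (Cst (cf c 2 * - (b / 2) + cf c 8))
                (Mul (Ex (b / 2)) (Add (term c 4 (2 * b) Sqx) (term c 6 (2 * b) Sqy)))))
  end.

(* This is c_0 v_1 + ... + c_8 v_9: the index of [c] is shifted by one. *)
Definition gen (c : 'rV[R]_9) : pt -> pt := vf (gexpr c).

Lemma pd_vf (E : dir -> expr R) (d : dir) s p : Omega p ->
  pd (vf E) (idx d) (map idx s) p = eval (foldr dexpr (E d) s) p.
Proof. by move=> Op; rewrite pd.unlock partial_vf // vfE // mxE idxK. Qed.

Lemma gen_linear (k : R) (c c' : 'rV[R]_9) : gen (k *: c + c') = k *: gen c + gen c'.
Proof.
apply/funext => p; rewrite -[RHS]/(k *: gen c p + gen c' p).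
have [Op|nOp] := pselect (Omega p); last by rewrite /gen !vf_out // scaler0 addr0.
apply/rowP => i; rewrite /gen !vfE // !mxE -[i]dir_ofK idxK.
by case: (dir_of i) => /=; rewrite /cf !mxE; ring.
Qed.

Lemma gens_gen (i : 'I_9) : (gens b)`_i = gen (delta_mx 0 i).
Proof.
apply/funext => p; have [Op|nOp] := pselect (Omega p); last first.
  rewrite /gen vf_out //.
  by case: i => -[|[|[|[|[|[|[|[|[|//]]]]]]]]] ? /=; rewrite /mk_vf; case: andP.
rewrite /gen vfE //; have [x0 y0] := Op.
have sxy : Num.sqrt (ptx p * pty p) = Num.sqrt (ptx p) * Num.sqrt (pty p).
  by rewrite sqrtrM // ltW.
have e1 : - (b * ptt p) = - b * ptt p by ring.
have e2 : b * ptt p / 2 = b / 2 * ptt p by field.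
have e3 : - (b / 2 * ptt p) = - (b / 2) * ptt p by ring.
have h n (hn : (n < 9)%N) m : (m < 9)%N -> cf (delta_mx 0 (Ordinal hn)) m = (m == n)%:R.
  by move=> hm; rewrite /cf mxE eqxx -val_eqE /= inordK.
case: i => -[|[|[|[|[|[|[|[|[|//]]]]]]]]] hi /=; rewrite /mk_vf x0 y0 /=;
  apply/rowP => j; rewrite !mxE -[j]dir_ofK idxK ?sxy ?e1 ?e2 ?e3;
  case: (dir_of j) => /=; rewrite !h //= ?mulr0n ?mulr1n -/(ptx p) -/(pty p) -/(ptt p) -/(ptu p); try ring.
Qed.

(** Every exponential of the generators becomes a power of the single unknown exp (b t / 2), since
    [field] does not relate exponentials to one another. *)
Lemma expR_split (t : R) :
  (expR (b * t) = expR (b / 2 * t) ^+ 2) * (expR (- b * t) = (expR (b / 2 * t))^-1 ^+ 2)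
  * (expR (- (b / 2) * t) = (expR (b / 2 * t))^-1).
Proof.
rewrite !mulNr !expRN; have -> : b * t = b / 2 * t + b / 2 * t by field.
by rewrite expRD; split; first split; rewrite // ?exprVn expr2.
Qed.

Lemma gen_smooth c : smooth_on_Omega (gen c).
Proof. exact: vf_smooth. Qed.

Lemma gen_projectable c p : Omega p -> projectable_at (gen c) p.
Proof.
move=> Op; split=> [j k|||].
- have := @pd_vf (gexpr c) (dir_of (indep j)) _ p Op.
  rewrite dir_ofK => H; have Hk := dir_ofK (indep k).
  rewrite -[indep k]dir_ofK.
  have := H [:: dU]; have := H [:: dU; dir_of (indep k)].
  have := H [:: dir_of (indep k); dU]; have := H [:: dU; dU].
  move=> /= -> -> -> ->.
  case: j {H} => -[|[|[|//]]] hj; case: k {Hk} => -[|[|[|//]]] hk /=;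
   by split; [|split; [|split]]; ring.
- by rewrite (pd_vf (gexpr c) dU [:: dU; dU]) //=; ring.
- rewrite (pd_vf (gexpr c) dT [:: dX]) // (pd_vf (gexpr c) dT [:: dY]) //=.
  by split; ring.
- rewrite (pd_vf (gexpr c) dT [:: dX; dX]) // (pd_vf (gexpr c) dT [:: dY; dY]) //=.
  by split; ring.
Qed.

Lemma gen_symmetry c (z : jet2) : is_jet2 z ->
  Delta 4^-1 b 4^-1 b z = 0 -> pr2 (gen c) (Delta 4^-1 b 4^-1 b) z = 0.
Proof.
move=> [Oz sz]; rewrite pr2_projectable //; [|exact: gen_smooth|exact: gen_projectable].
set p := z.1.1 in Oz *.
have H d s := @pd_vf (gexpr c) d s p Oz.
rewrite (H dX [::]) (H dX [:: dX]) (H dX [:: dY]) (H dX [:: dT]) (H dX [:: dX; dX]) (H dX [:: dY; dY]).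
rewrite (H dY [::]) (H dY [:: dX]) (H dY [:: dY]) (H dY [:: dT]) (H dY [:: dX; dX]) (H dY [:: dY; dY]).
rewrite (H dT [:: dT]) (H dU [:: dX]) (H dU [:: dY]) (H dU [:: dT]) (H dU [:: dU]).
rewrite (H dU [:: dX; dU]) (H dU [:: dU; dX]) (H dU [:: dY; dU]) (H dU [:: dU; dY]).
rewrite (H dU [:: dX; dX]) (H dU [:: dY; dY]) /=.
rewrite /Delta /= -!/(ptx p) -!/(pty p) -!/(ptt p) -!/(ptu p).
have [x0 y0] := Oz.
have : ptx p = Num.sqrt (ptx p) ^+ 2 by rewrite sqr_sqrtr // ltW.
have : pty p = Num.sqrt (pty p) ^+ 2 by rewrite sqr_sqrtr // ltW.
have : Num.sqrt (ptx p) != 0 by rewrite sqrtr_eq0 -ltNge.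
have : Num.sqrt (pty p) != 0 by rewrite sqrtr_eq0 -ltNge.
rewrite !expR_split.
have : expR (b / 2 * ptt p) != 0 by rewrite gt_eqF // expR_gt0.
move: (expR _) (Num.sqrt (ptx p)) (Num.sqrt (pty p)) => e s r.
move: (ptx p) (pty p) (ptu p) => x y u e0 r0 s0 -> ->.
move: (cf c 0) (cf c 1) (cf c 2) (cf c 3) (cf c 4) (cf c 5) (cf c 6) (cf c 7) (cf c 8).
move=> c0 c1 c2 c3 c4 c5 c6 c7 c8.
move: (z.1.2 0 ix) (z.1.2 0 iy) (z.1.2 0 it) (z.2 ix ix) (z.2 iy iy) (z.2 ix iy).
(* u_t is the last summand of [Delta], so the equation is solved for it; the goal becomes an
   identity in the free jet coordinates. *)
move=> q0 q1 q2 m00 m11 m01 /eqP; rewrite addrC addr_eq0 => /eqP ->.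
clear -e0 s0 r0.
by field; rewrite e0 r0 s0.
Qed.

Lemma derive_pd (w : pt -> pt) (p h : pt) j : differentiable w p ->
  'D_h w p 0 j = \sum_k h 0 k * pd w j [:: k] p.
Proof.
move=> dw; rewrite deriveE // [in LHS](row_sum_delta h) raddf_sum summxE.
apply: eq_bigr => k _; rewrite pd.unlock /= /partial deriveE //.
have -> : 'd w p (h 0 k *: delta_mx 0 k) = h 0 k *: 'd w p (delta_mx 0 k).
  exact: (linearZZ ('d w p)).
by rewrite mxE.
Qed.

Lemma vf_br_pd (v w : pt -> pt) p j : differentiable v p -> differentiable w p ->
  vf_br v w p 0 j =
  \sum_k pd v k [::] p * pd w j [:: k] p - \sum_k pd w k [::] p * pd v j [:: k] p.
Proof.
move=> dv dw; rewrite /vf_br !mxE !derive_pd //.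
by congr (_ - _); apply: eq_bigr => k _; rewrite pd0E.
Qed.

Definition minor (c d : 'rV[R]_9) (i j : nat) : R := cf c i * cf d j - cf c j * cf d i.

(** The structure constants: the factor of [minor c d i j] in entry k is the coefficient of v_(k+1)
    in [v_(i+1), v_(j+1)]. The fields v_5, ..., v_9 span a Heisenberg algebra with centre v_9; v_4
    rotates the pairs (v_5, v_7) and (v_6, v_8), and v_1, v_2, v_3 act on (v_5, v_6) and on (v_7,
    v_8) as sl_2 acts on the plane. *)
Definition coef_br (c d : 'rV[R]_9) : 'rV[R]_9 :=
  \row_(k < 9) [:: b * minor c d 2 0; - b * minor c d 2 1; - (2 * b) * minor c d 0 1; 0;
     b / 2 * minor c d 2 4 - b * minor c d 0 5 - 2^-1 * minor c d 3 6;
     - (b / 2) * minor c d 2 5 + b * minor c d 1 4 - 2^-1 * minor c d 3 7;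
     b / 2 * minor c d 2 6 - b * minor c d 0 7 + 2^-1 * minor c d 3 4;
     - (b / 2) * minor c d 2 7 + b * minor c d 1 6 + 2^-1 * minor c d 3 5;
     - b * minor c d 4 5 - b * minor c d 6 7]`_k%N.

Lemma gen_br c d : vf_br (gen c) (gen d) = gen (coef_br c d).
Proof.
apply/funext => p.
have [Op|nOp] := pselect (Omega p); last first.
  by rewrite /vf_br /gen !vf_out // !derive0 subrr.
apply/rowP => i; rewrite vf_br_pd; [|exact: (gen_smooth _ [::])..].
rewrite [RHS]pd0E !sum_dir -[i]dir_ofK; move: (dir_of i) => {}i.
have G f j : pd (gen f) (idx j) [::] p = eval (gexpr f j) p.
  exact: (@pd_vf (gexpr f) j [::] p Op).
have P f j k : pd (gen f) (idx j) [:: idx k] p = eval (dexpr k (gexpr f j)) p.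
  exact: (@pd_vf (gexpr f) j [:: k] p Op).
rewrite !P !G.
have W n (hn : (n < 9)%N) l : cf (\row_(k < 9) l`_k) n = l`_n by rewrite /cf mxE inordK.
(* Unfolding one side only turns this into a rewriting rule in which the entries of [coef_br] are
   already evaluated. *)
have : gexpr (coef_br c d) = gexpr (coef_br c d) by [].
rewrite {2}/gexpr /term /coef_br !W //= /minor => ->.
have [x0 y0] := Op.
have : ptx p = Num.sqrt (ptx p) ^+ 2 by rewrite sqr_sqrtr // ltW.
have : pty p = Num.sqrt (pty p) ^+ 2 by rewrite sqr_sqrtr // ltW.
have : Num.sqrt (ptx p) != 0 by rewrite sqrtr_eq0 -ltNge.
have : Num.sqrt (pty p) != 0 by rewrite sqrtr_eq0 -ltNge.
have : expR (b / 2 * ptt p) != 0 by rewrite gt_eqF // expR_gt0.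
case: i => /=; rewrite -!/(ptx p) -!/(pty p) -!/(ptt p) -?/(ptu p) !expR_split;
  move: (expR _) (Num.sqrt (ptx p)) (Num.sqrt (pty p)) => e s r;
  move: (ptx p) (pty p) (ptu p) => x y u e0 r0 s0 -> ->;
  move: (cf c 0) (cf c 1) (cf c 2) (cf c 3) (cf c 4) (cf c 5) (cf c 6) (cf c 7) (cf c 8);
  move=> c0 c1 c2 c3 c4 c5 c6 c7 c8;
  move: (cf d 0) (cf d 1) (cf d 2) (cf d 3) (cf d 4) (cf d 5) (cf d 6) (cf d 7) (cf d 8);
  move=> d0 d1 d2 d3 d4 d5 d6 d7 d8; clear -e0 s0 r0.
by field; rewrite ?e0 ?s0 ?r0.
by field; rewrite ?e0 ?s0 ?r0.
by field; rewrite ?e0 ?s0 ?r0.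
by field; rewrite ?e0 ?s0 ?r0.
Qed.

End Generators.

(** * The determining equations *)

Section RealFunctions.
Context (R : realType).
Implicit Types f g : R -> R.

Lemma is_derive_unique f g (x a c : R) : is_derive x 1 f a -> is_derive x 1 g c ->
  (\forall y \near x, f y = g y) -> a = c.
Proof.
by move=> hf hg E; rewrite -(is_deriveE hf) -(is_deriveE hg) (near_eq_derive _ E).
Qed.

Lemma is_derive_unique_all f g (x a c : R) :
  is_derive x 1 f a -> is_derive x 1 g c -> (forall y, f y = g y) -> a = c.
Proof. by move=> hf hg /funext E; rewrite -(is_deriveE hf) -(is_deriveE hg) E. Qed.

Lemma is_derive_unique_pos f g (x a c : R) : 0 < x ->
  is_derive x 1 f a -> is_derive x 1 g c -> (forall y : R, 0 < y -> f y = g y) -> a = c.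
Proof.
move=> x0 hf hg E; apply: (is_derive_unique hf hg).
by near=> y; apply: E; near: y; exact: lt_nbhsr.
Unshelve. all: by end_near. Qed.

(** The exponential maps the line onto the half-line, and its composite with [f] has zero derivative
    on the whole line. *)
Lemma is_derive_pos_cst f : (forall x : R, 0 < x -> is_derive x 1 f 0) ->
  forall x y : R, 0 < x -> 0 < y -> f x = f y.
Proof.
move=> h x y x0 y0.
rewrite -(lnK x0) -(lnK y0).
apply: (@is_derive_0_is_cst _ (fun t => f (expR t))) => t.
rewrite -(mul0r (expR t)); apply: (@is_derive1_comp _ f expR).
exact: (h _ (expR_gt0 t)).
Qed.

Lemma is_derive_expM (k t : R) : is_derive t 1 (fun t => expR (k * t)) (k * expR (k * t)).
Proof.
rewrite mulrC; apply: (@is_derive1_comp _ expR (fun t => k * t)).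
apply: (is_derive_eq (is_derive_mul (is_derive_const k t 1) (is_derive_id t 1))).
by rewrite mul0r add0r mulr1.
Qed.

Lemma is_derive_cexp (k w t : R) :
  is_derive t 1 (fun t => k * expR (w * t)) (k * (w * expR (w * t))).
Proof.
apply: (is_derive_eq (is_derive_mul (is_derive_const k t 1) (is_derive_expM w t))).
by rewrite mul0r add0r.
Qed.

Lemma linear_ode k f : (forall t : R, is_derive t 1 f (k * f t)) ->
  forall t, f t = f 0 * expR (k * t).
Proof.
move=> h t.
have : f t * expR (- k * t) = f 0 * expR (- k * 0).
  apply: (@is_derive_0_is_cst _ (fun t => f t * expR (- k * t))) => s.
  by apply: (is_derive_eq (is_derive_mul (h s) (is_derive_expM (- k) s))); ring.
rewrite mulr0 expR0 mulr1 => <-; rewrite -mulrA -expRD.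
by rewrite mulNr addNr expR0 mulr1.
Qed.

Lemma is_derive_inv (s : R) : s != 0 -> is_derive s 1 (fun s => s^-1) (- s^-1 ^+ 2).
Proof.
move=> s0; apply: (is_derive_eq (is_deriveV s0 (is_derive_id s 1))).
by rewrite [_ *: _]mulr1 exprVn.
Qed.

Lemma is_derive_sq (s : R) : is_derive s 1 (fun s => s ^+ 2) (2 * s).
Proof.
apply: (is_derive_eq (is_derive_mul (is_derive_id s 1) (is_derive_id s 1))).
by ring.
Qed.

End RealFunctions.

(** * Restriction to coordinate lines *)

Section Slices.
Context (R : realType).
Notation pt := 'rV[R]_4.
Context (v : pt -> pt) (sv : smooth_on_Omega v).

Definition mkp (x y t u : R) : pt :=
  \row_i match dir_of i with dX => x | dY => y | dT => t | dU => u end.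

Lemma mkpE (p : pt) : p = mkp (ptx p) (pty p) (ptt p) (ptu p).
Proof. by apply/rowP => i; rewrite mxE -{1}[i]dir_ofK; case: (dir_of i). Qed.

Lemma mkp_coord x y t u :
  (ptx (mkp x y t u) = x) * (pty (mkp x y t u) = y) * (ptt (mkp x y t u) = t)
  * (ptu (mkp x y t u) = u).
Proof. by rewrite /ptx /pty /ptt /ptu !mxE. Qed.

Lemma Omega_mkp (x y t u : R) : 0 < x -> 0 < y -> Omega (mkp x y t u).
Proof. by move=> x0 y0; rewrite /Omega /= !mkp_coord. Qed.

Lemma pd_slice d j l (x y t u : R) : 0 < x -> 0 < y ->
  is_derive (match d with dX => x | dY => y | dT => t | dU => u end) 1
    (fun h => pd v j l (match d with dX => mkp h y t u | dY => mkp x h t u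
                        | dT => mkp x y h u | dU => mkp x y t h end))
    (pd v j (idx d :: l) (mkp x y t u)).
Proof.
move=> x0 y0; apply/(@is_derive_lineP R R).
have /is_derive_lineP := pd_is_derive sv j l (idx d) (Omega_mkp t u x0 y0).
congr is_derive; apply/funext => h; congr pd.
apply/rowP => i; rewrite !mxE eqxx -[i]dir_ofK.
by case: d; case: (dir_of i); rewrite !mxE /= ?mulr0 ?add0r.
Qed.

End Slices.

(** * Consequences of the symmetry condition *)

Section Symmetry.
Context (R : realType) (b : R).
Notation pt := 'rV[R]_4.
Notation jet2 := (pt * 'rV[R]_3 * 'M[R]_3)%type.
Context (v : pt -> pt) (sv : smooth_on_Omega v).
Context (hv : forall z, is_jet2 z -> Delta 4^-1 b 4^-1 b z = 0 ->
  pr2 v (Delta 4^-1 b 4^-1 b) z = 0).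
Context (lam : R -> R -> R -> R)
  (hlam : forall p, Omega p -> vf_phi v p = lam (ptx p) (pty p) (ptt p) * ptu p).

Local Notation X := (indep ix).
Local Notation Y := (indep iy).
Local Notation T := (indep it).
Local Notation U := (ord_max : 'I_4).
Local Notation pd := (pd v).

(* The 2-jet over p with u_tt = 0 solving the equation for u_t. *)
Definition jet (p : pt) (q0 q1 m00 m11 m01 m02 m12 : R) : jet2 :=
  let x := ptx p in let y := pty p in
  (p, \row_(i < 3) [:: q0; q1; - ((4^-1 - b * x) * q0 + (4^-1 - b * y) * q1
                                 + x / 2 * m00 + y / 2 * m11)]`_i,
   \matrix_(i < 3, j < 3) [:: [:: m00; m01; m02]`_j; [:: m01; m11; m12]`_j;
                             [:: m02; m12; 0]`_j]`_i).

Lemma jet_is_jet2 p q0 q1 m00 m11 m01 m02 m12 : Omega p ->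
  is_jet2 (jet p q0 q1 m00 m11 m01 m02 m12).
Proof.
move=> Op; split=> //; apply/matrixP => -[i hi] [j hj]; rewrite !mxE /=.
by case: i hi => [|[|[|//]]] _; case: j hj => [|[|[|//]]] _.
Qed.

Lemma jet_Delta p q0 q1 m00 m11 m01 m02 m12 :
  Delta 4^-1 b 4^-1 b (jet p q0 q1 m00 m11 m01 m02 m12) = 0.
Proof. by rewrite /Delta /jet !mxE /=; ring. Qed.

Lemma pd_near0 j s : (forall p, Omega p -> pd j s p = 0) ->
  forall k p, Omega p -> pd j (k :: s) p = 0.
Proof.
move=> h k p Op; rewrite -(is_deriveE (pd_is_derive sv j s k Op)).
rewrite (@near_eq_derive _ _ _ _ (cst 0)) ?derive_cst //.
by apply: filterS (near_Omega Op) => q /h.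
Qed.

(** On jets with u_xx = u_yy = 0, subtracting the value at zero mixed derivatives isolates the part
    containing u_xy, u_xt and u_yt. Values 0 and 1 of these and of u_x, u_y then separate the five
    unknowns, those differentiated in u being the ones multiplied by u_x or u_y. *)
Lemma projectable_firstorder p : Omega p ->
  [/\ pd T [:: X] p = 0, pd T [:: Y] p = 0, pd T [:: U] p = 0,
      pd X [:: U] p = 0 & pd Y [:: U] p = 0].
Proof.
move=> Op; have [x0 y0] := Op.
have E q0 q1 m01 m02 m12 := hv (jet_is_jet2 q0 q1 0 0 m01 m02 m12 Op) (jet_Delta _ _ _ _ _ _ _ _).
have d1 i : (i == i :> 'I_3)%:R = 1 :> R by rewrite eqxx.
have d0 : ((ix == iy)%:R = 0 :> R) * ((ix == it)%:R = 0 :> R)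
  * ((iy == ix)%:R = 0 :> R) * ((iy == it)%:R = 0 :> R) by [].
have F q0 q1 m01 m02 m12 :
  ptx p * (m01 * (pd Y [:: X] p + q0 * pd Y [:: U] p) + m02 * (pd T [:: X] p + q0 * pd T [:: U] p))
  + pty p * (m01 * (pd X [:: Y] p + q1 * pd X [:: U] p) + m12 * (pd T [:: Y] p + q1 * pd T [:: U] p)) = 0.
  have := E q0 q1 m01 m02 m12; have := E q0 q1 0 0 0.
  rewrite !pr2_DeltaE // /prol2_expr /dprol1 /= !sum_indep !d1 !d0 !pd0E !mxE /=.
  by lra.
have F1 := F 0 0 0 1 0; have F2 := F 1 0 0 1 0; have F3 := F 0 0 0 0 1.
have G1 := F 0 0 1 0 0; have G2 := F 1 0 1 0 0; have G3 := F 0 1 1 0 0.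
have K (x a : R) : 0 < x -> x * a = 0 -> a = 0.
  by move=> /lt0r_neq0/negPf x_neq0 /eqP; rewrite mulf_eq0 x_neq0 => /eqP.
split; [apply: (K _ _ x0)|apply: (K _ _ y0)|apply: (K _ _ x0)|apply: (K _ _ y0)|
  apply: (K _ _ x0)]; lra.
Qed.

(** At u = 1 nothing is lost: xi, gamma and tau do not depend on u, and phi = lambda u, so that [at1
    U [::]] is lambda. *)
Definition at1 j l (x y t : R) : R := pd j l (mkp x y t 1).

(** The direction [dU] receives the dummy function 0, so that a single statement covers x, y and
    t. *)
Lemma at1_slice d j l (x y t : R) : 0 < x -> 0 < y ->
  is_derive (match d with dX => x | dY => y | _ => t end) 1
    (fun h => match d with dX => at1 j l h y t | dY => at1 j l x h t
                        | dT => at1 j l x y h | dU => 0 end)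
    (match d with dU => 0 | _ => at1 j (idx d :: l) x y t end).
Proof.
move=> x0 y0; have := pd_slice sv d j l t 1 x0 y0.
by case: d => // _; exact: is_derive_const.
Qed.

Lemma pd_u (j : 'I_3) x y t u : 0 < x -> 0 < y ->
  pd (indep j) [::] (mkp x y t u) = at1 (indep j) [::] x y t.
Proof.
move=> x0 y0; apply: (@is_derive_0_is_cst _ (fun u => pd (indep j) [::] (mkp x y t u))) => u'.
have := pd_slice sv dU (indep j) [::] t u' x0 y0; congr is_derive.
have [_ _ TU XU YU] := projectable_firstorder (Omega_mkp t u' x0 y0).
by elim/indep_ind: j.
Qed.

Lemma phi_u x y t u : 0 < x -> 0 < y ->
  pd U [::] (mkp x y t u) = u * at1 U [::] x y t.
Proof.
move=> x0 y0; have H w : pd U [::] (mkp x y t w) = lam x y t * w.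
  by rewrite pd.unlock [LHS](hlam (Omega_mkp _ _ x0 y0)) !mkp_coord.
by rewrite /at1 !H mulr1 mulrC.
Qed.

Lemma phi_U x y t u : 0 < x -> 0 < y -> pd U [:: U] (mkp x y t u) = at1 U [::] x y t.
Proof.
move=> x0 y0; have := is_derive_unique_all (pd_slice sv dU U [::] t u x0 y0)
  (is_derive_mul (is_derive_id u 1) (is_derive_const (at1 U [::] x y t) u 1)).
rewrite mul1r mulr0 addr0; apply.
by move=> w; exact: phi_u.
Qed.

Lemma pd_UU x y t u : 0 < x -> 0 < y -> pd U [:: U; U] (mkp x y t u) = 0.
Proof.
move=> x0 y0; apply: (is_derive_unique_all (pd_slice sv dU U [:: U] t u x0 y0)
  (is_derive_const (at1 U [::] x y t) u 1)).
by move=> w; exact: phi_U.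
Qed.

(** phi_u equals lambda for every x, so its x-derivative is that of lambda. The opposite order, in
    [at1_UX], comes from phi_x = u lambda_x. *)
Lemma at1_XU x y t : 0 < x -> 0 < y -> at1 U [:: X; U] x y t = at1 U [:: X] x y t.
Proof.
move=> x0 y0; apply: (is_derive_unique_pos x0 (at1_slice dX U [:: U] t x0 y0)
  (at1_slice dX U [::] t x0 y0)) => w w0.
exact: phi_U.
Qed.

Lemma at1_YU x y t : 0 < x -> 0 < y -> at1 U [:: Y; U] x y t = at1 U [:: Y] x y t.
Proof.
move=> x0 y0; apply: (is_derive_unique_pos y0 (at1_slice dY U [:: U] t x0 y0)
  (at1_slice dY U [::] t x0 y0)) => w w0.
exact: phi_U.
Qed.

Lemma pd_X_u x y t u : 0 < x -> 0 < y -> pd U [:: X] (mkp x y t u) = u * at1 U [:: X] x y t.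
Proof.
move=> x0 y0; have := is_derive_unique_pos x0 (pd_slice sv dX U [::] t u x0 y0)
  (is_derive_mul (is_derive_const u x 1) (at1_slice dX U [::] t x0 y0)).
by rewrite mul0r add0r; apply => w w0; exact: phi_u.
Qed.

Lemma pd_Y_u x y t u : 0 < x -> 0 < y -> pd U [:: Y] (mkp x y t u) = u * at1 U [:: Y] x y t.
Proof.
move=> x0 y0; have := is_derive_unique_pos y0 (pd_slice sv dY U [::] t u x0 y0)
  (is_derive_mul (is_derive_const u y 1) (at1_slice dY U [::] t x0 y0)).
by rewrite mul0r add0r; apply => w w0; exact: phi_u.
Qed.

Lemma at1_UX x y t : 0 < x -> 0 < y -> at1 U [:: U; X] x y t = at1 U [:: X] x y t.
Proof.
move=> x0 y0; have := is_derive_unique_all (pd_slice sv dU U [:: X] t 1 x0 y0)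
  (is_derive_mul (is_derive_id (1 : R) 1) (is_derive_const (at1 U [:: X] x y t) (1 : R) 1)).
rewrite mul1r mulr0 addr0; apply.
by move=> w; exact: pd_X_u.
Qed.

Lemma at1_UY x y t : 0 < x -> 0 < y -> at1 U [:: U; Y] x y t = at1 U [:: Y] x y t.
Proof.
move=> x0 y0; have := is_derive_unique_all (pd_slice sv dU U [:: Y] t 1 x0 y0)
  (is_derive_mul (is_derive_id (1 : R) 1) (is_derive_const (at1 U [:: Y] x y t) (1 : R) 1)).
rewrite mul1r mulr0 addr0; apply.
by move=> w; exact: pd_Y_u.
Qed.

Lemma pd_indep_U (j : 'I_3) p : Omega p -> pd (indep j) [:: U] p = 0.
Proof.
by move=> Op; have [? ? ? ? ?] := projectable_firstorder Op; elim/indep_ind: j.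
Qed.

Lemma pd_k_u (j k : 'I_3) x y t u : 0 < x -> 0 < y ->
  pd (indep j) [:: indep k] (mkp x y t u) = at1 (indep j) [:: indep k] x y t.
Proof.
move=> x0 y0; elim/indep_ind: k.
- apply: (is_derive_unique_pos x0 (pd_slice sv dX (indep j) [::] t u x0 y0)
    (at1_slice dX (indep j) [::] t x0 y0)) => w w0; exact: pd_u.
- apply: (is_derive_unique_pos y0 (pd_slice sv dY (indep j) [::] t u x0 y0)
    (at1_slice dY (indep j) [::] t x0 y0)) => w w0; exact: pd_u.
- apply: (is_derive_unique_all (pd_slice sv dT (indep j) [::] t u x0 y0)
    (at1_slice dT (indep j) [::] t x0 y0)); move=> w; exact: pd_u.
Qed.

Lemma symmetry_projectable x y t : 0 < x -> 0 < y -> projectable_at v (mkp x y t 1).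
Proof.
move=> x0 y0; have Op := Omega_mkp t 1 x0 y0; split.
- move=> j k; split; first exact: pd_indep_U.
  split; last by split; apply: pd_near0 => // p; exact: pd_indep_U.
  apply: (is_derive_unique_all (pd_slice sv dU (indep j) [:: indep k] t 1 x0 y0)
    (is_derive_const (at1 (indep j) [:: indep k] x y t) (1 : R) 1)).
  by move=> w; exact: pd_k_u.
- exact: pd_UU.
- by have [] := projectable_firstorder Op.
- by split; apply: pd_near0 => // p /projectable_firstorder[].
Qed.

Lemma determining_equations x y t : 0 < x -> 0 < y ->
  let xi l := at1 X l x y t in let ga l := at1 Y l x y t in
  let ta l := at1 T l x y t in let la l := at1 U l x y t in
  [/\ xi [::] / 2 - x * xi [:: X] + x / 2 * ta [:: T] = 0 /\
      ga [::] / 2 - y * ga [:: Y] + y / 2 * ta [:: T] = 0,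
      x * ga [:: X] + y * xi [:: Y] = 0,
      - b * xi [::] - (4^-1 - b * x) * xi [:: X] - (4^-1 - b * y) * xi [:: Y]
        + x * la [:: X] - x / 2 * xi [:: X; X] - y / 2 * xi [:: Y; Y]
        - xi [:: T] + (4^-1 - b * x) * ta [:: T] = 0,
      - b * ga [::] - (4^-1 - b * x) * ga [:: X] - (4^-1 - b * y) * ga [:: Y]
        + y * la [:: Y] - x / 2 * ga [:: X; X] - y / 2 * ga [:: Y; Y]
        - ga [:: T] + (4^-1 - b * y) * ta [:: T] = 0
    & (4^-1 - b * x) * la [:: X] + (4^-1 - b * y) * la [:: Y]
        + x / 2 * la [:: X; X] + y / 2 * la [:: Y; Y] + la [:: T] = 0].
Proof.
move=> x0 y0 xi ga ta la; have Op := Omega_mkp t 1 x0 y0.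
have pr := symmetry_projectable t x0 y0.
have E q0 q1 m00 m11 m01 :
    pr2 v (Delta 4^-1 b 4^-1 b) (jet (mkp x y t 1) q0 q1 m00 m11 m01 0 0) = 0.
  exact: hv (jet_is_jet2 _ _ _ _ _ _ _ Op) (jet_Delta _ _ _ _ _ _ _ _).
have {}E q0 q1 m00 m11 m01 :=
  etrans (esym (@pr2_projectable _ _ sv 4^-1 b 4^-1 b (jet (mkp x y t 1) q0 q1 m00 m11 m01 0 0) Op
    (jet_is_jet2 q0 q1 m00 m11 m01 0 0 Op).2 pr)) (E q0 q1 m00 m11 m01).
(* With u_t eliminated the condition is affine in u_x, u_y, u_xx, u_yy, u_xy; its values at the
   origin and at the five unit vectors determine its coefficients. *)
move: (E 0 0 0 0 0) (E 0 0 1 0 0) (E 0 0 0 1 0) (E 0 0 0 0 1) (E 1 0 0 0 0) (E 0 1 0 0 0) => {E}.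
rewrite /= !mxE /= !mkp_coord -!/(at1 _ _ _ _ _).
rewrite !at1_XU // !at1_UX // !at1_YU // !at1_UY //.
rewrite -!/(xi _) -!/(ga _) -!/(ta _) -!/(la _).
move=> E0 E1 E2 E3 E4 E5.
by split; [split|..]; lra.
Qed.

(** * Solution of the determining equations *)

Lemma at1_s j l (s r t : R) : 0 < s -> 0 < r ->
  is_derive s 1 (fun s => at1 j l (s ^+ 2) (r ^+ 2) t)
    (at1 j (X :: l) (s ^+ 2) (r ^+ 2) t * (2 * s)).
Proof.
move=> s0 r0; apply: (@is_derive1_comp _ (fun x => at1 j l x (r ^+ 2) t) (fun s => s ^+ 2)).
  by have := at1_slice dX j l t (exprn_gt0 2 s0) (exprn_gt0 2 r0).
exact: is_derive_sq.
Qed.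

Lemma at1_r j l (s r t : R) : 0 < s -> 0 < r ->
  is_derive r 1 (fun r => at1 j l (s ^+ 2) (r ^+ 2) t)
    (at1 j (Y :: l) (s ^+ 2) (r ^+ 2) t * (2 * r)).
Proof.
move=> s0 r0; apply: (@is_derive1_comp _ (fun y => at1 j l (s ^+ 2) y t) (fun r => r ^+ 2)).
  by have := at1_slice dY j l t (exprn_gt0 2 s0) (exprn_gt0 2 r0).
exact: is_derive_sq.
Qed.

Lemma at1_t j l (x y t : R) : 0 < x -> 0 < y ->
  is_derive t 1 (fun t => at1 j l x y t) (at1 j (T :: l) x y t).
Proof. by move=> x0 y0; have := at1_slice dT j l t x0 y0. Qed.

Lemma tau_xy (x y t : R) : 0 < x -> 0 < y -> at1 T [::] x y t = at1 T [::] 1 1 t.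
Proof.
move=> x0 y0; transitivity (at1 T [::] 1 y t).
  apply: (@is_derive_pos_cst _ (fun x => at1 T [::] x y t)) => // w w0.
  have := at1_slice dX T [::] t w0 y0; rewrite /at1.
  by have [-> _ _ _ _] := projectable_firstorder (Omega_mkp t 1 w0 y0).
apply: (@is_derive_pos_cst _ (fun y => at1 T [::] 1 y t)) => // w w0.
have := at1_slice dY T [::] t ltr01 w0; rewrite /at1.
by have [_ -> _ _ _] := projectable_firstorder (Omega_mkp t 1 ltr01 w0).
Qed.

Lemma tauT_xy (x y t : R) : 0 < x -> 0 < y -> at1 T [:: T] x y t = at1 T [:: T] 1 1 t.
Proof.
move=> x0 y0; apply: (is_derive_unique_all (at1_t T [::] t x0 y0) (at1_t T [::] t ltr01 ltr01)).
by move=> w; exact: tau_xy.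
Qed.

(** [tau1] and [tau2] are tau' and tau''; [kap1], [alp1], [bet1] are the t-derivatives of [kap],
    [alp], [bet]. All are built from partial derivatives at x = y = 1, so that they can be
    differentiated again; the values of xi and gamma at that point fix [alp] and [bet]. *)
Definition tau1 t := at1 T [:: T] 1 1 t.
Definition kap t := 2 * at1 X [:: Y] 1 1 t.
Definition alp t := at1 X [::] 1 1 t - tau1 t - kap t.
Definition bet t := at1 Y [::] 1 1 t - tau1 t + kap t.
Definition tau2 t := at1 T [:: T; T] 1 1 t.
Definition kap1 t := 2 * at1 X [:: T; Y] 1 1 t.
Definition alp1 t := at1 X [:: T] 1 1 t - tau2 t - kap1 t.
Definition bet1 t := at1 Y [:: T] 1 1 t - tau2 t + kap1 t.

(** The coefficient of u_xx says that xi / s has s-derivative tau', so xi / s - tau' s is constant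
    in s. *)
Lemma xi_in_s (s r t : R) : 0 < s -> 0 < r ->
  at1 X [::] (s ^+ 2) (r ^+ 2) t = s * (at1 X [::] 1 (r ^+ 2) t - tau1 t) + tau1 t * s ^+ 2.
Proof.
move=> s0 r0.
have : at1 X [::] (s ^+ 2) (r ^+ 2) t * s^-1 - tau1 t * s
     = at1 X [::] (1 ^+ 2) (r ^+ 2) t * 1^-1 - tau1 t * 1.
  apply: (@is_derive_pos_cst _ (fun s => at1 X [::] (s ^+ 2) (r ^+ 2) t * s^-1 - tau1 t * s)) => // w w0.
  have wn0 := lt0r_neq0 w0.
  apply: (is_derive_eq (is_derive_sub (is_derive_mul (at1_s X [::] t w0 r0) (is_derive_inv wn0))
    (is_derive_mul (is_derive_const (tau1 t) w 1) (is_derive_id w 1)))).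
  have [[H _] _ _ _ _] := determining_equations t (exprn_gt0 2 w0) (exprn_gt0 2 r0).
  move: H; rewrite tauT_xy ?exprn_gt0 // -/(tau1 t).
  move: (at1 X [::] _ _ _) (at1 X [:: X] _ _ _) => f g H.
  have -> : f = 2 * w ^+ 2 * g - w ^+ 2 * tau1 t by lra.
  by field.
rewrite expr1n invr1 !mulr1 => E.
have {E} : s * (at1 X [::] (s ^+ 2) (r ^+ 2) t * s^-1) = s * (at1 X [::] 1 (r ^+ 2) t - tau1 t + tau1 t * s).
  by rewrite -E subrK.
by rewrite mulrCA divff ?lt0r_neq0 // mulr1 => ->; ring.
Qed.

Lemma ga_in_r (s r t : R) : 0 < s -> 0 < r ->
  at1 Y [::] (s ^+ 2) (r ^+ 2) t = r * (at1 Y [::] (s ^+ 2) 1 t - tau1 t) + tau1 t * r ^+ 2.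
Proof.
move=> s0 r0.
have : at1 Y [::] (s ^+ 2) (r ^+ 2) t * r^-1 - tau1 t * r
     = at1 Y [::] (s ^+ 2) (1 ^+ 2) t * 1^-1 - tau1 t * 1.
  apply: (@is_derive_pos_cst _ (fun r => at1 Y [::] (s ^+ 2) (r ^+ 2) t * r^-1 - tau1 t * r)) => // w w0.
  have wn0 := lt0r_neq0 w0.
  apply: (is_derive_eq (is_derive_sub (is_derive_mul (at1_r Y [::] t s0 w0) (is_derive_inv wn0))
    (is_derive_mul (is_derive_const (tau1 t) w 1) (is_derive_id w 1)))).
  have [[_ H] _ _ _ _] := determining_equations t (exprn_gt0 2 s0) (exprn_gt0 2 w0).
  move: H; rewrite tauT_xy ?exprn_gt0 // -/(tau1 t).
  move: (at1 Y [::] _ _ _) (at1 Y [:: Y] _ _ _) => f g H.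
  have -> : f = 2 * w ^+ 2 * g - w ^+ 2 * tau1 t by lra.
  by field.
rewrite expr1n invr1 !mulr1 => E.
have {E} : r * (at1 Y [::] (s ^+ 2) (r ^+ 2) t * r^-1) = r * (at1 Y [::] (s ^+ 2) 1 t - tau1 t + tau1 t * r).
  by rewrite -E subrK.
by rewrite mulrCA divff ?lt0r_neq0 // mulr1 => ->; ring.
Qed.

Lemma xi_Y (s r t : R) : 0 < s -> 0 < r ->
  at1 X [:: Y] (s ^+ 2) (r ^+ 2) t = s * at1 X [:: Y] 1 (r ^+ 2) t.
Proof.
move=> s0 r0; have r2 := exprn_gt0 2 r0.
have := is_derive_unique_pos r2 (at1_slice dY X [::] t (exprn_gt0 2 s0) r2)
  (is_derive_add (is_derive_mul (is_derive_const s (r ^+ 2) 1)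
     (is_derive_sub (at1_slice dY X [::] t ltr01 r2) (is_derive_const (tau1 t) (r ^+ 2) 1)))
     (is_derive_const (tau1 t * s ^+ 2) (r ^+ 2) 1)).
rewrite mul0r add0r subr0 addr0; apply => y y0.
by rewrite -(sqr_sqrtr (ltW y0)) xi_in_s ?sqrtr_gt0.
Qed.

Lemma ga_X (s r t : R) : 0 < s -> 0 < r ->
  at1 Y [:: X] (s ^+ 2) (r ^+ 2) t = r * at1 Y [:: X] (s ^+ 2) 1 t.
Proof.
move=> s0 r0; have s2 := exprn_gt0 2 s0.
have := is_derive_unique_pos s2 (at1_slice dX Y [::] t s2 (exprn_gt0 2 r0))
  (is_derive_add (is_derive_mul (is_derive_const r (s ^+ 2) 1)
     (is_derive_sub (at1_slice dX Y [::] t s2 ltr01) (is_derive_const (tau1 t) (s ^+ 2) 1)))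
     (is_derive_const (tau1 t * r ^+ 2) (s ^+ 2) 1)).
rewrite mul0r add0r subr0 addr0; apply => x x0.
by rewrite -(sqr_sqrtr (ltW x0)) ga_in_r ?sqrtr_gt0.
Qed.

(** Separation of variables: by the coefficient of u_xy, a function of s alone is opposite to a
    function of r alone, so both are constant, and the value at 1 gives [kap]. *)
Lemma rotation_part (s r t : R) : 0 < s -> 0 < r ->
  2 * (r * at1 X [:: Y] 1 (r ^+ 2) t) = kap t /\
  2 * (s * at1 Y [:: X] (s ^+ 2) 1 t) = - kap t.
Proof.
have H (s' r' : R) : 0 < s' -> 0 < r' ->
    s' * at1 Y [:: X] (s' ^+ 2) 1 t = - (r' * at1 X [:: Y] 1 (r' ^+ 2) t).
  move=> s0 r0.
  have [_ H _ _ _] := determining_equations t (exprn_gt0 2 s0) (exprn_gt0 2 r0).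
  move: H; rewrite ga_X // xi_Y //.
  move: (at1 X _ _ _ _) (at1 Y _ _ _ _) => f g H.
  have : (s' * r') * (s' * g + r' * f) = 0 by rewrite -[RHS]H; ring.
  by move/eqP; rewrite mulf_eq0 gt_eqF ?mulr_gt0 //= addr_eq0 => /eqP.
move=> s0 r0; have := H s r s0 r0; have := H 1 r ltr01 r0; have := H 1 1 ltr01 ltr01.
by rewrite !expr1n /kap => ? ? ?; split; lra.
Qed.

Lemma xiE (s r t : R) : 0 < s -> 0 < r ->
  at1 X [::] (s ^+ 2) (r ^+ 2) t = tau1 t * s ^+ 2 + kap t * (r * s) + alp t * s.
Proof.
move=> s0 r0; rewrite xi_in_s //.
have : at1 X [::] (1 ^+ 2) (r ^+ 2) t - kap t * r = at1 X [::] (1 ^+ 2) (1 ^+ 2) t - kap t * 1.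
  apply: (@is_derive_pos_cst _ (fun r => at1 X [::] (1 ^+ 2) (r ^+ 2) t - kap t * r)) => // w w0.
  apply: (is_derive_eq (is_derive_sub (at1_r X [::] t ltr01 w0)
    (is_derive_mul (is_derive_const (kap t) w 1) (is_derive_id w 1)))).
  rewrite xi_Y //; have [H _] := rotation_part t w0 w0.
  by rewrite -H; ring.
rewrite !expr1n /alp mulr1 => /eqP; rewrite subr_eq => /eqP ->; ring.
Qed.

Lemma gaE (s r t : R) : 0 < s -> 0 < r ->
  at1 Y [::] (s ^+ 2) (r ^+ 2) t = tau1 t * r ^+ 2 - kap t * (r * s) + bet t * r.
Proof.
move=> s0 r0; rewrite ga_in_r //.
have : at1 Y [::] (s ^+ 2) (1 ^+ 2) t + kap t * s = at1 Y [::] (1 ^+ 2) (1 ^+ 2) t + kap t * 1.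
  apply: (@is_derive_pos_cst _ (fun s => at1 Y [::] (s ^+ 2) (1 ^+ 2) t + kap t * s)) => // w w0.
  apply: (is_derive_eq (is_derive_add (at1_s Y [::] t w0 ltr01)
    (is_derive_mul (is_derive_const (kap t) w 1) (is_derive_id w 1)))).
  rewrite ga_X //; have [_ H] := rotation_part t w0 w0.
  by rewrite -[kap t]opprK -H; ring.
rewrite !expr1n /bet mulr1 => /eqP; rewrite -subr_eq0 => /eqP H.
have -> : at1 Y [::] (s ^+ 2) 1 t = at1 Y [::] 1 1 t + kap t - kap t * s by lra.
ring.
Qed.

Lemma tau1_t (t : R) : is_derive t 1 tau1 (tau2 t).
Proof. exact: (at1_t T [:: T] t ltr01 ltr01). Qed.

Lemma kap_t (t : R) : is_derive t 1 kap (kap1 t).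
Proof.
apply: (is_derive_eq (is_derive_mul (is_derive_const 2 t 1) (at1_t X [:: Y] t ltr01 ltr01))).
by rewrite mul0r add0r.
Qed.

Lemma alp_t (t : R) : is_derive t 1 alp (alp1 t).
Proof.
exact: (is_derive_sub (is_derive_sub (at1_t X [::] t ltr01 ltr01) (tau1_t t)) (kap_t t)).
Qed.

Lemma bet_t (t : R) : is_derive t 1 bet (bet1 t).
Proof.
exact: (is_derive_add (is_derive_sub (at1_t Y [::] t ltr01 ltr01) (tau1_t t)) (kap_t t)).
Qed.

Lemma xi_X (s r t : R) : 0 < s -> 0 < r ->
  at1 X [:: X] (s ^+ 2) (r ^+ 2) t = tau1 t + (kap t * r + alp t) / 2 * s^-1.
Proof.
move=> s0 r0; have sn0 := lt0r_neq0 s0.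
have H := is_derive_unique_pos s0 (at1_s X [::] t s0 r0)
  (is_derive_add (is_derive_add (is_derive_mul (is_derive_const (tau1 t) s 1) (is_derive_sq s))
   (is_derive_mul (is_derive_const (kap t) s 1)
     (is_derive_mul (is_derive_const r s 1) (is_derive_id s 1))))
   (is_derive_mul (is_derive_const (alp t) s 1) (is_derive_id s 1)))
  (fun w w0 => xiE t w0 r0).
have : at1 X [:: X] (s ^+ 2) (r ^+ 2) t * (2 * s) / (2 * s)
     = at1 X [:: X] (s ^+ 2) (r ^+ 2) t by rewrite mulfK // mulf_neq0.
by move=> <-; rewrite H; field.
Qed.

Lemma xi_XX (s r t : R) : 0 < s -> 0 < r ->
  at1 X [:: X; X] (s ^+ 2) (r ^+ 2) t = - (kap t * r + alp t) / 4 * s^-1 ^+ 3.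
Proof.
move=> s0 r0; have sn0 := lt0r_neq0 s0.
have H := is_derive_unique_pos s0 (at1_s X [:: X] t s0 r0)
  (is_derive_add (is_derive_const (tau1 t) s 1)
    (is_derive_mul (is_derive_const ((kap t * r + alp t) / 2) s 1) (is_derive_inv sn0)))
  (fun w w0 => xi_X t w0 r0).
have : at1 X [:: X; X] (s ^+ 2) (r ^+ 2) t * (2 * s) / (2 * s)
     = at1 X [:: X; X] (s ^+ 2) (r ^+ 2) t by rewrite mulfK // mulf_neq0.
by move=> <-; rewrite H; field.
Qed.

Lemma xi_Y' (s r t : R) : 0 < s -> 0 < r ->
  at1 X [:: Y] (s ^+ 2) (r ^+ 2) t = kap t * s / 2 * r^-1.
Proof.
move=> s0 r0; have rn0 := lt0r_neq0 r0; rewrite xi_Y //.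
by have [<- _] := rotation_part t s0 r0; field.
Qed.

Lemma xi_YY (s r t : R) : 0 < s -> 0 < r ->
  at1 X [:: Y; Y] (s ^+ 2) (r ^+ 2) t = - (kap t * s) / 4 * r^-1 ^+ 3.
Proof.
move=> s0 r0; have rn0 := lt0r_neq0 r0.
have H := is_derive_unique_pos r0 (at1_r X [:: Y] t s0 r0)
    (is_derive_mul (is_derive_const (kap t * s / 2) r 1) (is_derive_inv rn0))
  (fun w w0 => xi_Y' t s0 w0).
have : at1 X [:: Y; Y] (s ^+ 2) (r ^+ 2) t * (2 * r) / (2 * r)
     = at1 X [:: Y; Y] (s ^+ 2) (r ^+ 2) t by rewrite mulfK // mulf_neq0.
by move=> <-; rewrite H; field.
Qed.

Lemma xi_T (s r t : R) : 0 < s -> 0 < r ->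
  at1 X [:: T] (s ^+ 2) (r ^+ 2) t = tau2 t * s ^+ 2 + kap1 t * (r * s) + alp1 t * s.
Proof.
move=> s0 r0.
have := is_derive_unique_all (at1_t X [::] t (exprn_gt0 2 s0) (exprn_gt0 2 r0))
  (is_derive_add (is_derive_add (is_derive_mul (tau1_t t) (is_derive_const (s ^+ 2) t 1))
    (is_derive_mul (kap_t t) (is_derive_const (r * s) t 1)))
    (is_derive_mul (alp_t t) (is_derive_const s t 1))) (fun w => xiE w s0 r0).
by rewrite !mulr0 !addr0.
Qed.

Lemma ga_Y (s r t : R) : 0 < s -> 0 < r ->
  at1 Y [:: Y] (s ^+ 2) (r ^+ 2) t = tau1 t + (- kap t * s + bet t) / 2 * r^-1.
Proof.
move=> s0 r0; have rn0 := lt0r_neq0 r0.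
have H := is_derive_unique_pos r0 (at1_r Y [::] t s0 r0)
  (is_derive_add (is_derive_sub (is_derive_mul (is_derive_const (tau1 t) r 1) (is_derive_sq r))
   (is_derive_mul (is_derive_const (kap t) r 1)
     (is_derive_mul (is_derive_id r 1) (is_derive_const s r 1))))
   (is_derive_mul (is_derive_const (bet t) r 1) (is_derive_id r 1)))
  (fun w w0 => gaE t s0 w0).
have : at1 Y [:: Y] (s ^+ 2) (r ^+ 2) t * (2 * r) / (2 * r)
     = at1 Y [:: Y] (s ^+ 2) (r ^+ 2) t by rewrite mulfK // mulf_neq0.
by move=> <-; rewrite H; field.
Qed.

Lemma ga_YY (s r t : R) : 0 < s -> 0 < r ->
  at1 Y [:: Y; Y] (s ^+ 2) (r ^+ 2) t = - (- kap t * s + bet t) / 4 * r^-1 ^+ 3.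
Proof.
move=> s0 r0; have rn0 := lt0r_neq0 r0.
have H := is_derive_unique_pos r0 (at1_r Y [:: Y] t s0 r0)
  (is_derive_add (is_derive_const (tau1 t) r 1)
    (is_derive_mul (is_derive_const ((- kap t * s + bet t) / 2) r 1) (is_derive_inv rn0)))
  (fun w w0 => ga_Y t s0 w0).
have : at1 Y [:: Y; Y] (s ^+ 2) (r ^+ 2) t * (2 * r) / (2 * r)
     = at1 Y [:: Y; Y] (s ^+ 2) (r ^+ 2) t by rewrite mulfK // mulf_neq0.
by move=> <-; rewrite H; field.
Qed.

Lemma ga_X' (s r t : R) : 0 < s -> 0 < r ->
  at1 Y [:: X] (s ^+ 2) (r ^+ 2) t = - (kap t * r) / 2 * s^-1.
Proof.
move=> s0 r0; have sn0 := lt0r_neq0 s0; rewrite ga_X //.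
by have [_ H] := rotation_part t s0 r0; rewrite -[kap t]opprK -H; field.
Qed.

Lemma ga_XX (s r t : R) : 0 < s -> 0 < r ->
  at1 Y [:: X; X] (s ^+ 2) (r ^+ 2) t = kap t * r / 4 * s^-1 ^+ 3.
Proof.
move=> s0 r0; have sn0 := lt0r_neq0 s0.
have H := is_derive_unique_pos s0 (at1_s Y [:: X] t s0 r0)
    (is_derive_mul (is_derive_const (- (kap t * r) / 2) s 1) (is_derive_inv sn0))
  (fun w w0 => ga_X' t w0 r0).
have : at1 Y [:: X; X] (s ^+ 2) (r ^+ 2) t * (2 * s) / (2 * s)
     = at1 Y [:: X; X] (s ^+ 2) (r ^+ 2) t by rewrite mulfK // mulf_neq0.
by move=> <-; rewrite H; field.
Qed.

Lemma ga_T (s r t : R) : 0 < s -> 0 < r ->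
  at1 Y [:: T] (s ^+ 2) (r ^+ 2) t = tau2 t * r ^+ 2 - kap1 t * (r * s) + bet1 t * r.
Proof.
move=> s0 r0.
have := is_derive_unique_all (at1_t Y [::] t (exprn_gt0 2 s0) (exprn_gt0 2 r0))
  (is_derive_add (is_derive_sub (is_derive_mul (tau1_t t) (is_derive_const (r ^+ 2) t 1))
    (is_derive_mul (kap_t t) (is_derive_const (r * s) t 1)))
    (is_derive_mul (bet_t t) (is_derive_const r t 1))) (fun w => gaE w s0 r0).
by rewrite !mulr0 !addr0.
Qed.

(** * The multiplier lambda *)

Definition lP t := tau2 t + b * tau1 t.
Definition lQ t := 2 * alp1 t + b * alp t.
Definition lS t := 2 * bet1 t + b * bet t.

(** This is the coefficient of u_x. The singular terms cancel in pairs because a = d = 1/4: those in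
    1 / s of xi_x / 4 and (x / 2) xi_xx are opposite, and so are those in 1 / r of xi_y / 4 and (y /
    2) xi_yy. *)
Lemma la_s (s r t : R) : 0 < s -> 0 < r ->
  at1 U [:: X] (s ^+ 2) (r ^+ 2) t * (2 * s) = 2 * s * lP t + lQ t + 2 * kap1 t * r.
Proof.
move=> s0 r0; have sn0 := lt0r_neq0 s0; have rn0 := lt0r_neq0 r0.
have [_ _ H _ _] := determining_equations t (exprn_gt0 2 s0) (exprn_gt0 2 r0).
move: H; rewrite xiE // xi_X // xi_Y' // xi_XX // xi_YY // xi_T //.
rewrite tauT_xy ?exprn_gt0 // -/(tau1 t) /lP /lQ.
move: (at1 U _ _ _ _) => L H.
apply: (mulfI sn0); apply: subr0_eq; rewrite -[RHS](mulr0 2) -[in RHS]H.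
by field; rewrite sn0 rn0.
Qed.

Lemma la_r (s r t : R) : 0 < s -> 0 < r ->
  at1 U [:: Y] (s ^+ 2) (r ^+ 2) t * (2 * r) = 2 * r * lP t + lS t - 2 * kap1 t * s.
Proof.
move=> s0 r0; have sn0 := lt0r_neq0 s0; have rn0 := lt0r_neq0 r0.
have [_ _ _ H _] := determining_equations t (exprn_gt0 2 s0) (exprn_gt0 2 r0).
move: H; rewrite gaE // ga_X' // ga_Y // ga_XX // ga_YY // ga_T //.
rewrite tauT_xy ?exprn_gt0 // -/(tau1 t) /lP /lS.
move: (at1 U _ _ _ _) => L H.
apply: (mulfI rn0); apply: subr0_eq; rewrite -[RHS](mulr0 2) -[in RHS]H.
by field; rewrite sn0 rn0.
Qed.

(* The mixed second difference of lambda over a rectangle in (s, r), computed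
   with each of the two partial derivatives, gives opposite values. *)
Lemma kap1_0 (t : R) : kap1 t = 0.
Proof.
pose H s r := at1 U [::] (s ^+ 2) (r ^+ 2) t - lP t * s ^+ 2 - lP t * r ^+ 2
  - lQ t * s - lS t * r.
have Hs (s r : R) : 0 < s -> 0 < r ->
    H s r - 2 * kap1 t * r * s = H 1 r - 2 * kap1 t * r * 1.
  move=> s0 r0; apply: (@is_derive_pos_cst _ (fun s => H s r - 2 * kap1 t * r * s)) => // w w0.
  apply: (is_derive_eq (is_derive_sub (is_derive_sub (is_derive_sub (is_derive_sub
    (is_derive_sub (at1_s U [::] t w0 r0) (is_derive_mul (is_derive_const (lP t) w 1) (is_derive_sq w)))
    (is_derive_const (lP t * r ^+ 2) w 1))
    (is_derive_mul (is_derive_const (lQ t) w 1) (is_derive_id w 1)))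
    (is_derive_const (lS t * r) w 1))
    (is_derive_mul (is_derive_const (2 * kap1 t * r) w 1) (is_derive_id w 1)))).
  by rewrite la_s //; ring.
have Hr (s r : R) : 0 < s -> 0 < r ->
    H s r + 2 * kap1 t * s * r = H s 1 + 2 * kap1 t * s * 1.
  move=> s0 r0; apply: (@is_derive_pos_cst _ (fun r => H s r + 2 * kap1 t * s * r)) => // w w0.
  apply: (is_derive_eq (is_derive_add (is_derive_sub (is_derive_sub (is_derive_sub
    (is_derive_sub (at1_r U [::] t s0 w0) (is_derive_const (lP t * s ^+ 2) w 1))
    (is_derive_mul (is_derive_const (lP t) w 1) (is_derive_sq w)))
    (is_derive_const (lQ t * s) w 1))
    (is_derive_mul (is_derive_const (lS t) w 1) (is_derive_id w 1)))
    (is_derive_mul (is_derive_const (2 * kap1 t * s) w 1) (is_derive_id w 1)))).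
  by rewrite la_r //; ring.
have p2 : (0 : R) < 2 by [].
have := Hs 2 1 p2 ltr01; have := Hs 2 2 p2 p2; have := Hr 1 2 ltr01 p2; have := Hr 2 2 p2 p2.
move: (H 2 2) (H 2 1) (H 1 2) (H 1 1) (kap1 t) => h22 h21 h12 h11 k.
by lra.
Qed.

Definition lf t := at1 U [::] 1 1 t - 2 * lP t - lQ t - lS t.

Lemma laE (s r t : R) : 0 < s -> 0 < r ->
  at1 U [::] (s ^+ 2) (r ^+ 2) t = lP t * (s ^+ 2 + r ^+ 2) + lQ t * s + lS t * r + lf t.
Proof.
move=> s0 r0.
have H1 : at1 U [::] (s ^+ 2) (r ^+ 2) t - lP t * s ^+ 2 - lQ t * s
   = at1 U [::] (1 ^+ 2) (r ^+ 2) t - lP t * 1 ^+ 2 - lQ t * 1.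
  apply: (@is_derive_pos_cst _ (fun s => at1 U [::] (s ^+ 2) (r ^+ 2) t - lP t * s ^+ 2 - lQ t * s)) => // w w0.
  apply: (is_derive_eq (is_derive_sub
    (is_derive_sub (at1_s U [::] t w0 r0) (is_derive_mul (is_derive_const (lP t) w 1) (is_derive_sq w)))
    (is_derive_mul (is_derive_const (lQ t) w 1) (is_derive_id w 1)))).
  by rewrite la_s // kap1_0; ring.
have H2 : at1 U [::] (1 ^+ 2) (r ^+ 2) t - lP t * r ^+ 2 - lS t * r
   = at1 U [::] (1 ^+ 2) (1 ^+ 2) t - lP t * 1 ^+ 2 - lS t * 1.
  apply: (@is_derive_pos_cst _ (fun r => at1 U [::] (1 ^+ 2) (r ^+ 2) t - lP t * r ^+ 2 - lS t * r)) => // w w0.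
  apply: (is_derive_eq (is_derive_sub
    (is_derive_sub (at1_r U [::] t ltr01 w0) (is_derive_mul (is_derive_const (lP t) w 1) (is_derive_sq w)))
    (is_derive_mul (is_derive_const (lS t) w 1) (is_derive_id w 1)))).
  by rewrite la_r // kap1_0; ring.
rewrite /lf; move: H1 H2; rewrite !expr1n.
by move: (at1 U _ _ _ _) (at1 U _ _ _ _) (at1 U _ _ _ _) (lP t) (lQ t) (lS t) => *; lra.
Qed.

Lemma la_X (s r t : R) : 0 < s -> 0 < r ->
  at1 U [:: X] (s ^+ 2) (r ^+ 2) t = lP t + lQ t / 2 * s^-1.
Proof.
move=> s0 r0; have sn0 := lt0r_neq0 s0; apply: (@mulIf _ (2 * s)).
  by rewrite mulf_neq0.
by rewrite la_s // kap1_0; field.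
Qed.

Lemma la_Y (s r t : R) : 0 < s -> 0 < r ->
  at1 U [:: Y] (s ^+ 2) (r ^+ 2) t = lP t + lS t / 2 * r^-1.
Proof.
move=> s0 r0; have rn0 := lt0r_neq0 r0; apply: (@mulIf _ (2 * r)).
  by rewrite mulf_neq0.
by rewrite la_r // kap1_0; field.
Qed.

Lemma la_XX (s r t : R) : 0 < s -> 0 < r ->
  at1 U [:: X; X] (s ^+ 2) (r ^+ 2) t = - lQ t / 4 * s^-1 ^+ 3.
Proof.
move=> s0 r0; have sn0 := lt0r_neq0 s0; apply: (@mulIf _ (2 * s)).
  by rewrite mulf_neq0.
have -> := is_derive_unique_pos s0 (at1_s U [:: X] t s0 r0)
  (is_derive_add (is_derive_const (lP t) s 1)
    (is_derive_mul (is_derive_const (lQ t / 2) s 1) (is_derive_inv sn0)))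
  (fun w w0 => la_X t w0 r0).
by field.
Qed.

Lemma la_YY (s r t : R) : 0 < s -> 0 < r ->
  at1 U [:: Y; Y] (s ^+ 2) (r ^+ 2) t = - lS t / 4 * r^-1 ^+ 3.
Proof.
move=> s0 r0; have rn0 := lt0r_neq0 r0; apply: (@mulIf _ (2 * r)).
  by rewrite mulf_neq0.
have -> := is_derive_unique_pos r0 (at1_r U [:: Y] t s0 r0)
  (is_derive_add (is_derive_const (lP t) r 1)
    (is_derive_mul (is_derive_const (lS t / 2) r 1) (is_derive_inv rn0)))
  (fun w w0 => la_Y t s0 w0).
by field.
Qed.

(** The derivatives produced here involve third derivatives such as tau'''; their values are
    identified afterwards, in [coefficient_odes], by comparing coefficients. *)
Lemma derivable_coefficients (t : R) : exists P' Q' S' F',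
  [/\ is_derive t 1 lP P', is_derive t 1 lQ Q', is_derive t 1 lS S' & is_derive t 1 lf F'].
Proof.
have d2 : is_derive t 1 tau2 (at1 T [:: T; T; T] 1 1 t) := at1_t T [:: T; T] t ltr01 ltr01.
have dk : is_derive t 1 kap1 0.
  by rewrite (_ : kap1 = fun=> 0); [exact: is_derive_const | apply/funext => w; rewrite kap1_0].
have da := is_derive_sub (is_derive_sub (at1_t X [:: T] t ltr01 ltr01) d2) dk.
have db := is_derive_add (is_derive_sub (at1_t Y [:: T] t ltr01 ltr01) d2) dk.
have dP := is_derive_add d2 (is_derive_mul (is_derive_const b t 1) (tau1_t t)).
have dQ := is_derive_add (is_derive_mul (is_derive_const 2 t 1) da)
  (is_derive_mul (is_derive_const b t 1) (alp_t t)).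
have dS := is_derive_add (is_derive_mul (is_derive_const 2 t 1) db)
  (is_derive_mul (is_derive_const b t 1) (bet_t t)).
have df := is_derive_sub (is_derive_sub (is_derive_sub (at1_t U [::] t ltr01 ltr01)
  (is_derive_mul (is_derive_const 2 t 1) dP)) dQ) dS.
by do 4 eexists; split; [exact: dP | exact: dQ | exact: dS | exact: df].
Qed.

Lemma coefficient_odes (t : R) :
  [/\ is_derive t 1 lP (b * lP t), is_derive t 1 lQ (b / 2 * lQ t),
      is_derive t 1 lS (b / 2 * lS t) & is_derive t 1 lf (- lP t / 2)].
Proof.
have [P' [Q' [S' [F' [dP dQ dS df]]]]] := derivable_coefficients t.
have H (s r : R) : 0 < s -> 0 < r ->
  lP t / 2 - b * lP t * (s ^+ 2 + r ^+ 2) - b * lQ t / 2 * s - b * lS t / 2 * r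
  + P' * (s ^+ 2 + r ^+ 2) + Q' * s + S' * r + F' = 0.
  move=> s0 r0; have sn0 := lt0r_neq0 s0; have rn0 := lt0r_neq0 r0.
  have := is_derive_unique_all (at1_t U [::] t (exprn_gt0 2 s0) (exprn_gt0 2 r0))
    (is_derive_add (is_derive_add (is_derive_add
      (is_derive_mul dP (is_derive_const (s ^+ 2 + r ^+ 2) t 1))
      (is_derive_mul dQ (is_derive_const s t 1)))
      (is_derive_mul dS (is_derive_const r t 1))) df) (fun w => laE w s0 r0).
  rewrite !mulr0 !addr0 => LT.
  have [_ _ _ _ E] := determining_equations t (exprn_gt0 2 s0) (exprn_gt0 2 r0).
  move: E; rewrite la_X // la_Y // la_XX // la_YY // LT => E.
  by rewrite -[RHS]E; field; rewrite sn0 rn0.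
have p2 : (0 : R) < 2 by []. have p3 : (0 : R) < 3 by [].
(* [H] is a relation between s^2 + r^2, s, r and 1, which are linearly independent on these four
   points, so each coefficient vanishes. *)
have := H 1 1 ltr01 ltr01; have := H 2 1 p2 ltr01; have := H 3 1 p3 ltr01; have := H 1 2 ltr01 p2.
clear H; move=> H1 H2 H3 H4.
split; [apply: (is_derive_eq dP)|apply: (is_derive_eq dQ)|apply: (is_derive_eq dS)|
  apply: (is_derive_eq df)]; move: H1 H2 H3 H4;
  by move: (lP t) (lQ t) (lS t) => p q s *; lra.
Qed.

(** * The nine constants of integration *)

Lemma symmetry_is_gen : b != 0 -> (forall p, ~ Omega p -> v p = 0) ->
  exists c, v = gen b c.
Proof.
move=> b0 vout.
have hP : forall t, lP t = lP 0 * expR (b * t).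
  by apply: linear_ode => t; have [] := coefficient_odes t.
have hQ : forall t, lQ t = lQ 0 * expR (b / 2 * t).
  by apply: linear_ode => t; have [] := coefficient_odes t.
have hS : forall t, lS t = lS 0 * expR (b / 2 * t).
  by apply: linear_ode => t; have [] := coefficient_odes t.
have hf (t : R) : lf t + lP t / (2 * b) = lf 0 + lP 0 / (2 * b).
  apply: (@is_derive_0_is_cst _ (fun t => lf t + lP t / (2 * b))) => w.
  have [dP _ _ df] := coefficient_odes w.
  apply: (is_derive_eq (is_derive_add df (is_derive_mul dP (is_derive_const (2 * b)^-1 w 1)))).
  by field.
have hk (t : R) : kap t = kap 0.
  apply: is_derive_0_is_cst => w; rewrite -(kap1_0 w); exact: kap_t.
(* P / (2 b) is a particular solution for tau' of tau'' + b tau' = P; the difference solves the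
   homogeneous equation. *)
pose g1 t := tau1 t - lP 0 / (2 * b) * expR (b * t).
have h1 : forall t, g1 t = g1 0 * expR (- b * t).
  apply: linear_ode => t.
  apply: (is_derive_eq (is_derive_sub (tau1_t t) (is_derive_cexp (lP 0 / (2 * b)) b t))).
  have : tau2 t = lP 0 * expR (b * t) - b * tau1 t by rewrite -hP /lP addrK.
  by rewrite /g1 => ->; field.
(* Integrating tau' makes these the coefficients of exp (b t) and exp (- b t) in tau. *)
pose c0 := lP 0 / (2 * b ^+ 2). pose c1 := - g1 0 / b.
pose ta t := at1 T [::] 1 1 t.
have h2 (t : R) : ta t - c0 * expR (b * t) - c1 * expR (- b * t) = ta 0 - c0 - c1.
  transitivity (ta 0 - c0 * expR (b * 0) - c1 * expR (- b * 0)); last first.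
    by rewrite !mulr0 expR0 !mulr1.
  apply: (@is_derive_0_is_cst _ (fun t => ta t - c0 * expR (b * t) - c1 * expR (- b * t))) => w.
  apply: (is_derive_eq (is_derive_sub (is_derive_sub (at1_t T [::] w ltr01 ltr01)
    (is_derive_cexp c0 b w)) (is_derive_cexp c1 (- b) w))).
  have : at1 T [:: T] 1 1 w = g1 0 * expR (- b * w) + lP 0 / (2 * b) * expR (b * w).
    by rewrite -h1 /g1 subrK.
  by move=> ->; rewrite /c0 /c1; field.
(* Likewise Q / (2 b) is a particular solution of 2 alp' + b alp = Q. *)
pose g2 t := alp t - lQ 0 / (2 * b) * expR (b / 2 * t).
have h3 : forall t, g2 t = g2 0 * expR (- (b / 2) * t).
  apply: linear_ode => t.
  apply: (is_derive_eq (is_derive_sub (alp_t t) (is_derive_cexp (lQ 0 / (2 * b)) (b / 2) t))).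
  have : alp1 t = (lQ 0 * expR (b / 2 * t) - b * alp t) / 2.
    by rewrite -hQ /lQ addrK mulrAC divff ?mul1r // pnatr_eq0.
  by rewrite /g2 => ->; field.
pose g3 t := bet t - lS 0 / (2 * b) * expR (b / 2 * t).
have h4 : forall t, g3 t = g3 0 * expR (- (b / 2) * t).
  apply: linear_ode => t.
  apply: (is_derive_eq (is_derive_sub (bet_t t) (is_derive_cexp (lS 0 / (2 * b)) (b / 2) t))).
  have : bet1 t = (lS 0 * expR (b / 2 * t) - b * bet t) / 2.
    by rewrite -hS /lS addrK mulrAC divff ?mul1r // pnatr_eq0.
  by rewrite /g3 => ->; field.
pose c2 := ta 0 - c0 - c1.
(* The last entry is the constant part of lambda plus [b / 2 * c2], which offsets the term - (b / 2)
   u of v_3. *)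
pose cs := [:: c0; c1; c2; kap 0; lQ 0 / (2 * b); g2 0; lS 0 / (2 * b); g3 0;
  lf 0 + lP 0 / (2 * b) + b / 2 * c2].
pose c : 'rV[R]_9 := \row_(i < 9) cs`_i.
have hc n : (n < 9)%N -> cf c n = cs`_n by move=> hn; rewrite /cf mxE inordK.
have e1 t : tau1 t = g1 0 * expR (- b * t) + lP 0 / (2 * b) * expR (b * t).
  by rewrite -h1 /g1 subrK.
have e2 t : ta t = c2 + c1 * expR (- b * t) + c0 * expR (b * t).
  by rewrite /c2 -(h2 t); ring.
have e3 t : alp t = g2 0 * expR (- (b / 2) * t) + lQ 0 / (2 * b) * expR (b / 2 * t).
  by rewrite -h3 /g2 subrK.
have e4 t : bet t = g3 0 * expR (- (b / 2) * t) + lS 0 / (2 * b) * expR (b / 2 * t).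
  by rewrite -h4 /g3 subrK.
have e5 t : lf t = lf 0 + lP 0 / (2 * b) - lP 0 * expR (b * t) / (2 * b).
  by rewrite -(hf t) -hP addrK.
exists c; apply/funext => p.
have [Op|nOp] := pselect (Omega p); last by rewrite vout // /gen vf_out.
rewrite /gen vfE //; apply/rowP => i; rewrite mxE -[i]dir_ofK idxK; move: (dir_of i) => {}i.
have [x0 y0] := Op.
rewrite (mkpE p) pd0E in x0 y0 *.
move: (ptx p) (pty p) (ptt p) (ptu p) x0 y0 => x y t u x0 y0; rewrite !mkp_coord in x0 y0.
have [s [s0 xs]] : exists s, 0 < s /\ x = s ^+ 2.
  by exists (Num.sqrt x); rewrite sqrtr_gt0 sqr_sqrtr ?ltW.
have [r [r0 yr]] : exists r, 0 < r /\ y = r ^+ 2.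
  by exists (Num.sqrt y); rewrite sqrtr_gt0 sqr_sqrtr ?ltW.
have ss : Num.sqrt x = s by rewrite xs sqrtr_sqr ger0_norm // ltW.
have sr : Num.sqrt y = r by rewrite yr sqrtr_sqr ger0_norm // ltW.
case: i; rewrite /= -?/(ptx _) -?/(pty _) -?/(ptt _) -?/(ptu _) !mkp_coord ?ss ?sr !hc //=.
- by rewrite (pd_u ix) // xs yr xiE // hk e1 e3 /c0 /c1; field.
- by rewrite (pd_u iy) // xs yr gaE // hk e1 e4 /c0 /c1; field.
- by rewrite (pd_u it) // tau_xy // -/(ta t) e2; ring.
- by rewrite phi_u // xs yr laE // hP hQ hS e5 /c0; field.
Qed.

End Symmetry.

(** * Structure of the Lie algebra *)

Section LieGeneral.
Context (F : fieldType) (L S : lieAlgType F) (J : set L) (hJ : is_lie_ideal J).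

Lemma lie0r (x : L) : lie x 0 = 0.
Proof. by rewrite -[in LHS](subrr 0) lieBr subrr. Qed.

Lemma lieNr (x y : L) : lie x (- y) = - lie x y.
Proof. by rewrite -[in LHS]sub0r lieBr lie0r sub0r. Qed.

Lemma lie_first_isomorphism (p : L -> S) : linear p ->
  (forall x y, p (lie x y) = lie (p x) (p y)) -> (forall s, exists x, p x = s) ->
  (forall x, J x <-> p x = 0) ->
  exists f : quot_lie hJ -> S, lie_iso f /\ forall x, f (lie_pi hJ x) = p x.
Proof.
move=> plin pbr psurj pker.
have pB x y : p (x - y) = p x - p y by rewrite addrC -scaleN1r plin scaleN1r addrC.
pose f (q : quot_lie hJ) : S := p (repr q).
have fE x : f (lie_pi hJ x) = p x.
  by apply/eqP; rewrite -subr_eq0 -pB; apply/eqP/pker; exact: repr_pi.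
exists f; split=> //; split.
- move=> k q q'; case: (lie_pi_surj q) => x <-; case: (lie_pi_surj q') => y <-.
  by rewrite -linearP !fE plin.
- move=> q q'; case: (lie_pi_surj q) => x <-; case: (lie_pi_surj q') => y <-.
  by rewrite [lie (lie_pi _ _) _]lie_pi_lie !fE pbr.
- have [g gK] := choice psurj.
  exists (fun s => lie_pi hJ (g s)); last by move=> s; rewrite fE gK.
  move=> q; case: (lie_pi_surj q) => x <-; apply/lie_pi_eq/pker.
  by rewrite pB fE gK subrr.
Qed.

(** The section [l] lets S act on J by theta s = [l s, -]. The isomorphism sends (s, j) to l s + j,
    with inverse x to (p x, x - l (p x)). *)
Lemma lie_split_semidirect (p : L -> S) (l : S -> L) : linear p -> linear l ->
  (forall s s', l (lie s s') = lie (l s) (l s')) -> cancel l p ->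
  (forall x, J x <-> p x = 0) ->
  exists (theta : S -> ideal_lie hJ -> ideal_lie hJ) (htheta : is_lie_action theta)
         (g : semidirect htheta -> L),
    lie_iso g /\ forall j : ideal_lie hJ, g (0, j) = val j.
Proof.
move=> plin llin lbr lK pker.
have pB x y : p (x - y) = p x - p y by rewrite addrC -scaleN1r plin scaleN1r addrC.
have jac (x y z : L) : lie x (lie y z) = lie (lie x y) z + lie y (lie x z).
  have /eqP := lie_jacobi x y z; rewrite -addrA addr_eq0 => /eqP ->.
  by rewrite opprD addrC -(lieC (lie x y) z) (lieC z x) lieNr opprK.
pose HJ := ideal_is_lie_algebra hJ.
have Jval (j : ideal_lie hJ) : J (val j) by exact: (Defs.sub_mem (j : sub_lie HJ)).
pose theta (s : S) (j : ideal_lie hJ) : ideal_lie hJ :=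
  sub_mk HJ (ideal_br hJ (l s) (Jval j)).
have htheta : is_lie_action theta.
  split.
  - by move=> k s s' x; apply: val_inj; rewrite /= llin lie_linearl.
  - by move=> s k x y; apply: val_inj; rewrite /= lie_linearr.
  - by move=> s x y; apply: val_inj; rewrite /= jac.
  - by move=> s s' x; apply: val_inj; rewrite /= lbr [X in _ = X - _]jac addrK.
exists theta, htheta.
pose g (z : semidirect htheta) : L := l z.1 + val z.2.
have l0 : l 0 = 0 by have := llin (-1) 0 0; rewrite scaler0 addr0 scaleN1r addNr.
exists g; split; last by move=> j; rewrite /g l0 add0r.
split.
- move=> k [s j] [s' j']; rewrite /g /= llin scalerDr.
  by rewrite addrACA.
- move=> [s j] [s' j']; rewrite /g /= lbr.
  rewrite lieDl !lieDr -!addrA; congr (_ + _).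
  by rewrite addrC -addrA; congr (_ + (_ + _)); rewrite -lieC.
- have hx x : J (x - l (p x)) by apply/pker; rewrite pB lK subrr.
  exists (fun x => (p x, sub_mk HJ (hx x)) : semidirect htheta).
    move=> [s j]; rewrite /g /=.
    have pj : p (l s + val j) = s.
      have := plin 1 (l s) (val j); rewrite !scale1r => ->.
      by rewrite lK ((pker _).1 (Jval j)) addr0.
    congr pair; first exact: pj.
    by apply: val_inj; rewrite /= pj addrC addKr.
  by move=> x; rewrite /g /= addrC subrK.
Qed.

End LieGeneral.

(** * The algebra in coordinates *)

Section Coefficients.
Context (R : realType) (b : R).
Implicit Types c d : 'rV[R]_9.

Lemma cf_linear k c d n : cf (k *: c + d) n = k * cf c n + cf d n.
Proof. by rewrite /cf !mxE. Qed.

Lemma cf_inj c d : (forall n, (n < 9)%N -> cf c n = cf d n) -> c = d.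
Proof.
by move=> h; apply/rowP => i; have := h i (ltn_ord i); rewrite /cf inord_val.
Qed.

Lemma cf_row (l : seq R) n : (n < 9)%N -> cf (\row_(k < 9) l`_k) n = l`_n.
Proof. by move=> hn; rewrite /cf mxE inordK. Qed.

Lemma cf_br c d n : (n < 9)%N -> cf (coef_br b c d) n =
  [:: b * minor c d 2 0; - b * minor c d 2 1; - (2 * b) * minor c d 0 1; 0;
     b / 2 * minor c d 2 4 - b * minor c d 0 5 - 2^-1 * minor c d 3 6;
     - (b / 2) * minor c d 2 5 + b * minor c d 1 4 - 2^-1 * minor c d 3 7;
     b / 2 * minor c d 2 6 - b * minor c d 0 7 + 2^-1 * minor c d 3 4;
     - (b / 2) * minor c d 2 7 + b * minor c d 1 6 + 2^-1 * minor c d 3 5;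
     - b * minor c d 4 5 - b * minor c d 6 7]`_n.
Proof. exact: cf_row. Qed.

Lemma coef_br_linl c c' d k : coef_br b (k *: c + c') d = k *: coef_br b c d + coef_br b c' d.
Proof.
apply: cf_inj => n hn; rewrite cf_linear !cf_br //.
by case: n hn => [|[|[|[|[|[|[|[|[|//]]]]]]]]] _ /=; rewrite /minor ?cf_linear; ring.
Qed.

Lemma coef_br_linr c d d' k : coef_br b c (k *: d + d') = k *: coef_br b c d + coef_br b c d'.
Proof.
apply: cf_inj => n hn; rewrite cf_linear !cf_br //.
by case: n hn => [|[|[|[|[|[|[|[|[|//]]]]]]]]] _ /=; rewrite /minor ?cf_linear; ring.
Qed.

Lemma cf0 n : cf (0 : 'rV[R]_9) n = 0.
Proof. by rewrite /cf mxE. Qed.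

Lemma coef_br_xx c : coef_br b c c = 0.
Proof.
apply: cf_inj => n hn; rewrite cf0 cf_br //.
by case: n hn => [|[|[|[|[|[|[|[|[|//]]]]]]]]] _ /=; rewrite /minor; ring.
Qed.

Lemma coef_br_jacobi c d e : coef_br b c (coef_br b d e) + coef_br b d (coef_br b e c)
  + coef_br b e (coef_br b c d) = 0.
Proof.
apply: cf_inj => n hn; rewrite cf0 -[X in X + _ + _]scale1r -addrA cf_linear mul1r.
rewrite -[X in _ + cf (X + _) n]scale1r cf_linear mul1r !cf_br //.
case: n hn => [|[|[|[|[|[|[|[|[|//]]]]]]]]] _;
  rewrite [LHS]/= /minor ?cf_br // ?[LHS]/= /minor; by field.
Qed.

Lemma gen0 : gen b 0 = 0.
Proof. by have := gen_linear b (-1) 0 0; rewrite scaler0 addr0 scaleN1r addNr. Qed.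

(** The time is chosen so that exp (b t / 2) = e; the field can then be evaluated at prescribed
    numbers s, r, e. *)
Lemma gen_mkp c (s r e u : R) : b != 0 -> 0 < s -> 0 < r -> 0 < e ->
  let p := mkp (s ^+ 2) (r ^+ 2) (ln e / (b / 2)) u in
  [/\ gen b c p 0 (idx dT) = cf c 0 * e ^+ 2 + cf c 1 * e^-1 ^+ 2 + cf c 2,
      gen b c p 0 (idx dX) = (cf c 0 * b * e ^+ 2 - cf c 1 * b * e^-1 ^+ 2) * s ^+ 2
        + s * (cf c 3 * r + cf c 4 * e + cf c 5 * e^-1),
      gen b c p 0 (idx dY) = (cf c 0 * b * e ^+ 2 - cf c 1 * b * e^-1 ^+ 2) * r ^+ 2
        + r * (- cf c 3 * s + cf c 6 * e + cf c 7 * e^-1)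
    & gen b c p 0 (idx dU) = u * (cf c 0 * (2 * b) * e ^+ 2 * (b * (s ^+ 2 + r ^+ 2) - 2^-1)
        - cf c 2 * (b / 2) + cf c 8 + e * (cf c 4 * (2 * b) * s + cf c 6 * (2 * b) * r))].
Proof.
move=> b0 s0 r0 e0 p.
have Op : Omega p by apply: Omega_mkp; exact: exprn_gt0.
have ee : expR (b / 2 * (ln e / (b / 2))) = e.
  by rewrite mulrC divfK ?lnK // mulf_neq0 ?invr_neq0 // pnatr_eq0.
have G (j : dir) : gen b c p 0 (idx j) = eval (gexpr b c j) p by rewrite /gen vfE // mxE idxK.
have ss : Num.sqrt (s ^+ 2) = s by rewrite sqrtr_sqr gtr0_norm.
have rr : Num.sqrt (r ^+ 2) = r by rewrite sqrtr_sqr gtr0_norm.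
have [px py pu] : [/\ ptx p = s ^+ 2, pty p = r ^+ 2 & ptu p = u] by rewrite !mkp_coord.
have {}ee : expR (b / 2 * ptt p) = e by rewrite mkp_coord.
move: p Op G px py pu ee => p Op G px py pu ee.
rewrite (G dT) (G dX) (G dY) (G dU) /= -!/(ptx p) -!/(pty p) -!/(ptt p) -!/(ptu p).
by rewrite px py pu ss rr !(expR_split b) ee; split; ring.
Qed.

(** tau at e = 1, 2, 3 gives the first three coefficients; xi and gamma at four points give the next
    five, and phi the last. *)
Lemma gen_eq0 c : b != 0 -> gen b c = 0 -> c = 0.
Proof.
move=> b0 E.
have p2 : (0 : R) < 2 by []. have p3 : (0 : R) < 3 by [].
have Z p i : gen b c p 0 i = 0 by rewrite E mxE.
have H (s r e : R) s0 r0 e0 := @gen_mkp c s r e 1 b0 s0 r0 e0.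
have c0 : cf c 0 = 0 /\ cf c 1 = 0 /\ cf c 2 = 0.
  have [h1 _ _ _] := H 1 1 1 ltr01 ltr01 ltr01.
  have [h2 _ _ _] := H 1 1 2 ltr01 ltr01 p2.
  have [h3 _ _ _] := H 1 1 3 ltr01 ltr01 p3.
  by move: h1 h2 h3; rewrite !Z => h1 h2 h3; split; [|split]; lra.
have [{}c0 [c1 c2]] := c0.
have [_ h1 k1 l1] := H 1 1 1 ltr01 ltr01 ltr01.
have [_ h2 k2 _] := H 2 1 1 p2 ltr01 ltr01.
have [_ h3 k3 _] := H 1 2 1 ltr01 p2 ltr01.
have [_ h4 k4 _] := H 1 1 2 ltr01 ltr01 p2.
move: h1 h2 h3 h4 k1 k2 k3 k4 l1; rewrite !Z c0 c1 c2 => h1 h2 h3 h4 k1 k2 k3 k4 l1.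
have c3 : cf c 3 = 0 by lra.
have c4 : cf c 4 = 0 by lra.
have c6 : cf c 6 = 0 by lra.
apply: cf_inj => n hn; rewrite cf0.
case: n hn => [|[|[|[|[|[|[|[|[|//]]]]]]]]] _ //; try lra.
by move: l1; rewrite c4 c6; lra.
Qed.

Lemma symmetries0_gen : b != 0 ->
  forall v, symmetries0 4^-1 b 4^-1 b v <-> exists c, v = gen b c.
Proof.
move=> b0 v; split.
  by move=> [[vout sv hv] [lam hlam]]; exact: (symmetry_is_gen sv hv hlam b0 vout).
move=> [c ->]; split.
  split; [by move=> p nOp; exact: vf_out | exact: gen_smooth |].
  by move=> z; exact: gen_symmetry.
(* lambda is the value of phi at u = 1. *)
exists (fun x y t => gen b c (mkp x y t 1) 0 ord_max) => p Op.
rewrite /vf_phi; have := dir_ofK ord_max => <-.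
rewrite /gen (vfE _ Op) vfE; last exact: Omega_mkp Op.1 Op.2.
by rewrite !mxE /= -!/(ptx _) -!/(pty _) -!/(ptt _) -!/(ptu _) !mkp_coord; ring.
Qed.

End Coefficients.

(** * The symmetry algebra and the ideal J *)

Section SymmetryAlgebra.
Context (R : realType) (b : R) (b0 : b != 0).
Implicit Types c : 'rV[R]_9.

(** Every element is a value of [gen], which carries [coef_br] to the bracket of fields, so each
    axiom follows from the corresponding identity for [coef_br]. *)
Lemma symmetries0_is_lie_algebra : is_lie_algebra (@vf_br R) (symmetries0 4^-1 b 4^-1 b).
Proof.
have E := symmetries0_gen b0.
split.
- by apply/E; exists 0; rewrite gen0.
- move=> k v w /E[c ->] /E[c' ->]; apply/E; exists (k *: c + c').
  by rewrite gen_linear.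
- by move=> v w /E[c ->] /E[c' ->]; apply/E; exists (coef_br b c c'); rewrite gen_br.
- move=> z k v w /E[d ->] /E[c ->] /E[c' ->].
  by rewrite -gen_linear !gen_br coef_br_linl gen_linear.
- move=> z k v w /E[d ->] /E[c ->] /E[c' ->].
  by rewrite -gen_linear !gen_br coef_br_linr gen_linear.
- by move=> v /E[c ->]; rewrite gen_br coef_br_xx gen0.
- move=> x y z /E[c ->] /E[d ->] /E[e ->]; rewrite !gen_br.
  have genD c1 c2 : gen b c1 + gen b c2 = gen b (c1 + c2).
    by rewrite -[c1]scale1r gen_linear !scale1r.
  by rewrite !genD coef_br_jacobi gen0.
Qed.

Local Notation L := (sub_lie symmetries0_is_lie_algebra).

Lemma gen_in c : symmetries0 4^-1 b 4^-1 b (gen b c).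
Proof. by apply/(symmetries0_gen b0); exists c. Qed.

Definition sgen c : L := sub_mk symmetries0_is_lie_algebra (gen_in c).

Lemma sgen_linear k c c' : sgen (k *: c + c') = k *: sgen c + sgen c'.
Proof. by apply: val_inj; rewrite /= gen_linear. Qed.

Lemma sgen_br c c' : lie (sgen c) (sgen c') = sgen (coef_br b c c').
Proof. by apply: val_inj; rewrite /= gen_br. Qed.

Lemma sgen_inj : injective sgen.
Proof.
move=> c c' /(congr1 val) /= E; apply/eqP; rewrite -subr_eq0; apply/eqP.
apply: (gen_eq0 b0); rewrite addrC -scaleN1r gen_linear E scaleN1r addNr //.
Qed.

Lemma sgen_surj (x : L) : exists c, sgen c = x.
Proof.
have /(symmetries0_gen b0)[c E] := Defs.sub_mem x.
by exists c; apply: val_inj; rewrite /= E.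
Qed.

Definition coef (x : L) : 'rV[R]_9 := sval (cid (sgen_surj x)).

Lemma coefK x : sgen (coef x) = x.
Proof. by rewrite /coef; case: cid. Qed.

Lemma sgenK c : coef (sgen c) = c.
Proof. by apply: sgen_inj; rewrite coefK. Qed.

Lemma coef_linear k x y : coef (k *: x + y) = k *: coef x + coef y.
Proof. by apply: sgen_inj; rewrite sgen_linear !coefK. Qed.

Definition basis_gen (i : 'I_9) : L := sgen (delta_mx 0 i).

Lemma sgen_sum (I : finType) (k : I -> R) (f : I -> 'rV[R]_9) :
  \sum_i k i *: sgen (f i) = sgen (\sum_i k i *: f i).
Proof.
have sgen0 : sgen 0 = 0 by apply: val_inj; rewrite /= gen0.
apply: (big_ind2 (fun x c => x = sgen c)) => // [x c y d -> ->|i _].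
  by rewrite -[c in RHS]scale1r sgen_linear scale1r.
by rewrite -[k i *: f i]addr0 sgen_linear sgen0 addr0.
Qed.

Lemma basis_gen_is_basis : is_basis basis_gen.
Proof.
split=> [k|].
  rewrite sgen_sum => E i; have : \sum_j k j *: (delta_mx 0 j : 'rV[R]_9) = 0.
    by apply: (gen_eq0 b0); exact: (congr1 val E).
  rewrite -[X in X = 0](_ : \row_j k j = _); last first.
    by rewrite [LHS]row_sum_delta; apply: eq_bigr => j _; rewrite mxE.
  by move/rowP/(_ i); rewrite !mxE.
apply/seteqP; split=> // x _; exists (fun i => coef x 0 i).
by rewrite sgen_sum -row_sum_delta coefK.
Qed.

Definition Jset : set L := lin_span (fun i : 'I_6 => basis_gen (rshift 3 i)).

Lemma JsetP x : Jset x <-> [/\ cf (coef x) 0 = 0, cf (coef x) 1 = 0 & cf (coef x) 2 = 0].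
Proof.
split.
  move=> [k ->]; rewrite sgen_sum sgenK.
  have Z n : (n < 3)%N -> cf (\sum_i k i *: (delta_mx 0 (rshift 3 i) : 'rV[R]_9)) n = 0.
    move=> hn; rewrite /cf summxE big1 // => i _; rewrite !mxE.
    rewrite (_ : (inord n == rshift 3 i :> 'I_9) = false) ?andbF ?mulr0 //.
    by rewrite -val_eqE /= inordK ?(ltn_trans hn) // ltn_eqF // (leq_trans hn) // leq_addr.
  by split; exact: Z.
move=> [h0 h1 h2]; exists (fun i => coef x 0 (rshift 3 i)).
rewrite sgen_sum -[LHS]coefK; congr sgen.
rewrite [LHS]row_sum_delta [LHS](@big_split_ord _ _ _ 3 6) /= big1 ?add0r // => i _.
rewrite (_ : coef x 0 (lshift 6 i) = cf (coef x) i); last first.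
  by rewrite /cf; congr (coef x 0 _); apply: val_inj; rewrite /= inordK // (leq_trans (ltn_ord i)).
by case: i => -[|[|[|//]]] hi /=; rewrite ?h0 ?h1 ?h2 scale0r.
Qed.

(** Entries 0, 1, 2 of [coef_br] contain only minors with both indices among 0, 1, 2, and these
    vanish when one argument lies in J. *)
Lemma Jset_ideal : is_lie_ideal Jset.
Proof.
split.
- have -> : (0 : L) = sgen 0 by apply: val_inj; rewrite /= gen0.
  by apply/JsetP; rewrite sgenK !cf0.
- move=> k x y /JsetP[x0 x1 x2] /JsetP[y0 y1 y2]; apply/JsetP.
  by rewrite coef_linear !cf_linear x0 x1 x2 y0 y1 y2 mulr0 addr0.
- move=> x y /JsetP[y0 y1 y2]; apply/JsetP.
  rewrite -[x]coefK -[y]coefK sgen_br sgenK !cf_br //= /minor y0 y1 y2.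
  by split; ring.
Qed.

Lemma Jset_basis_mem (i : 'I_6) : Jset (basis_gen (rshift 3 i)).
Proof.
exists (fun j => (j == i)%:R); rewrite (bigD1 i) //= eqxx scale1r big1 ?addr0 // => j /negbTE ->.
by rewrite scale0r.
Qed.

Lemma Jset_dim : has_dim (ideal_lie Jset_ideal) 6.
Proof.
pose e i : ideal_lie Jset_ideal :=
  sub_mk (ideal_is_lie_algebra Jset_ideal) (Jset_basis_mem i).
have eE (k : 'I_6 -> R) : val (\sum_i k i *: e i) = \sum_i k i *: basis_gen (rshift 3 i).
  by rewrite raddf_sum; apply: eq_bigr => i _ /=.
exists e; split.
  move=> k /(congr1 val); rewrite eE => E i.
  have [free _] := basis_gen_is_basis.
  (* The coefficients are extended by zero, to use the independence of all nine generators. *)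
  pose k' (j : 'I_9) := if fintype.split (j : 'I_(3 + 6)) is inr j' then k j' else 0.
  have /free/(_ (rshift 3 i)) : \sum_j k' j *: basis_gen j = 0.
    rewrite [LHS](@big_split_ord _ _ _ 3 6) /= big1 ?add0r => [|j _]; last first.
      by rewrite /k' (unsplitK (inl j)) scale0r.
    rewrite -[RHS]E; apply: eq_bigr => j _.
    by rewrite /k' (unsplitK (inr j)).
  by rewrite /k' (unsplitK (inr i)).
apply/seteqP; split=> // x _; have [k E] := Defs.sub_mem x.
by exists k; apply: val_inj; rewrite eE.
Qed.

End SymmetryAlgebra.

(** * The quotient by J and its lift *)

Section Levi.
Context (R : realType) (b : R) (b0 : b != 0).
Local Notation L := (sub_lie (symmetries0_is_lie_algebra b0)).

Lemma matrix2_eq (A B : 'M[R]_2) : A 0 0 = B 0 0 -> A 0 1 = B 0 1 ->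
  A 1 0 = B 1 0 -> A 1 1 = B 1 1 -> A = B.
Proof.
move=> h00 h01 h10 h11; apply/matrixP => i j.
case: i => -[|[|//]] hi; case: j => -[|[|//]] hj.
- by move: h00; congr (A _ _ = B _ _); exact: val_inj.
- by move: h01; congr (A _ _ = B _ _); exact: val_inj.
- by move: h10; congr (A _ _ = B _ _); exact: val_inj.
- by move: h11; congr (A _ _ = B _ _); exact: val_inj.
Qed.

(** The matrix - b c_0 E + b c_1 F + (b / 2) c_2 H: the prescribed images of v_1, v_2, v_3, extended
    by zero on J. *)
Definition sl2_mx (c : 'rV[R]_9) : 'M[R]_2 :=
  \matrix_(i < 2, j < 2) [:: [:: b / 2 * cf c 2; - b * cf c 0]`_j;
                            [:: b * cf c 1; - (b / 2 * cf c 2)]`_j]`_i.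

Lemma sl2_mx_tr c : sl2_set (sl2_mx c).
Proof. by rewrite /sl2_set /= /mxtrace !big_ord_recl big_ord0 !mxE /= addr0 subrr. Qed.

Definition to_sl2 (x : L) : sl2 R := sub_mk (sl2_is_lie_algebra R) (sl2_mx_tr (coef x)).

(** Entries 3 to 8 are the default 0 of the list, so the lift lands in the span of v_1, v_2, v_3. *)
Definition sl2_lift (A : 'M[R]_2) : 'rV[R]_9 :=
  \row_(k < 9) [:: - A 0 1 / b; A 1 0 / b; 2 / b * A 0 0]`_k.

Definition from_sl2 (A : sl2 R) : L := sgen b0 (sl2_lift (val A)).

Lemma to_sl2_linear : linear to_sl2.
Proof.
move=> k x y; apply: val_inj; apply/matrixP => i j; rewrite /= !mxE coef_linear !cf_linear.
by case: i => -[|[|//]] ?; case: j => -[|[|//]] ? /=; ring.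
Qed.

Lemma to_sl2_lie x y : to_sl2 (lie x y) = lie (to_sl2 x) (to_sl2 y).
Proof.
apply: val_inj; rewrite /= -{1}[x]coefK -{1}[y]coefK sgen_br sgenK.
apply/matrixP => i j; rewrite /mx_br !mxE !big_ord_recl !big_ord0 !mxE !cf_br //= /minor.
by case: i => -[|[|//]] ?; case: j => -[|[|//]] ? /=; field.
Qed.

Lemma from_sl2_linear : linear from_sl2.
Proof.
move=> k A B; rewrite /from_sl2 -sgen_linear; congr sgen; apply: cf_inj => n hn.
rewrite cf_linear !cf_row // !mxE.
by case: n hn => [|[|[|[|[|[|[|[|[|//]]]]]]]]] _ /=; ring.
Qed.

Lemma sl2_trace (A : sl2 R) : (val A) 1 1 = - (val A) 0 0.
Proof.
have := Defs.sub_mem A; rewrite /sl2_set /= /mxtrace !big_ord_recl big_ord0 addr0.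
rewrite (_ : lift ord0 ord0 = 1); last exact: val_inj.
by move=> /eqP; rewrite addrC addr_eq0 => /eqP.
Qed.

(** Every minor in entries 3 to 8 of [coef_br] has an index at least 3, so v_1, v_2, v_3 span a
    subalgebra; the zero trace expresses the lower diagonal entry by the upper one. *)
Lemma from_sl2_lie A B : from_sl2 (lie A B) = lie (from_sl2 A) (from_sl2 B).
Proof.
rewrite /from_sl2 sgen_br; congr sgen; apply: cf_inj => n hn.
rewrite cf_br // /minor !cf_row //= /mx_br !mxE !big_ord_recl !big_ord0.
rewrite (_ : lift ord0 ord0 = 1); last exact: val_inj.
rewrite !sl2_trace.
move: (val A 0 0) (val A 0 1) (val A 1 0) (val B 0 0) (val B 0 1) (val B 1 0) => *.
by case: n hn => [|[|[|[|[|[|[|[|[|//]]]]]]]]] _ /=; field.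
Qed.

Lemma from_sl2K : cancel from_sl2 to_sl2.
Proof.
move=> A; apply: val_inj; rewrite /= sgenK; apply: matrix2_eq;
  rewrite !mxE !cf_row //= ?sl2_trace; move: (val A 0 0) (val A 0 1) (val A 1 0) => *;
  by field.
Qed.

Lemma to_sl2_ker x : Jset x <-> to_sl2 x = 0.
Proof.
rewrite JsetP; split.
  move=> [h0 h1 h2]; apply: val_inj; apply/matrixP => i j; rewrite /= !mxE h0 h1 h2.
  by case: i => -[|[|//]] ?; case: j => -[|[|//]] ? /=; ring.
move=> /(congr1 val) /= /matrixP E.
have := E 0 0; have := E 0 1; have := E 1 0; rewrite !mxE /=.
move=> /eqP; rewrite mulf_eq0 (negPf b0) => /eqP h1.
move=> /eqP; rewrite mulf_eq0 oppr_eq0 (negPf b0) => /eqP h0.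
move=> /eqP; rewrite !mulf_eq0 (negPf b0) invr_eq0 pnatr_eq0 => /eqP h2.
by [].
Qed.

End Levi.

Theorem mainTheorem2 (R : realType) (a b d e : R)
    (ha : a = 4^-1) (hd : d = 4^-1) (hbe : b = e) (he : e != 0) :
  exists (hL : is_lie_algebra (@vf_br R) (symmetries0 a b d e))
         (v : 'I_9 -> sub_lie hL),
    (forall i : 'I_9, val (v i) = (gens b)`_i) /\
    is_basis v /\
    exists hJ : is_lie_ideal (lin_span (fun i : 'I_6 => v (rshift 3 i))),
      has_dim (ideal_lie hJ) 6 /\
      (exists f : quot_lie hJ -> sl2 R,
        [/\ lie_iso f,
            f (lie_pi hJ (v (@Ordinal 9 0 isT))) = - b *: sl2E R,
            f (lie_pi hJ (v (@Ordinal 9 1 isT))) = b *: sl2F R &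
            f (lie_pi hJ (v (@Ordinal 9 2 isT))) = (b / 2) *: sl2H R]) /\
      (exists (theta : sl2 R -> ideal_lie hJ -> ideal_lie hJ)
              (htheta : is_lie_action theta)
              (g : semidirect htheta -> sub_lie hL),
        lie_iso g /\ forall j : ideal_lie hJ, g (0, j) = val j).
Proof.
subst a d e.
exists (symmetries0_is_lie_algebra he), (basis_gen he); split.
  by move=> i; rewrite gens_gen.
split; first exact: basis_gen_is_basis.
exists (Jset_ideal he); split; first exact: Jset_dim.
split; last first.
  exact: (lie_split_semidirect (Jset_ideal he) (@to_sl2_linear _ _ he)
    (@from_sl2_linear _ _ he) (@from_sl2_lie _ _ he) (@from_sl2K _ _ he) (@to_sl2_ker _ _ he)).
have [f [fiso fE]] := lie_first_isomorphism (Jset_ideal he) (@to_sl2_linear _ _ he)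
  (@to_sl2_lie _ _ he) (fun A => ex_intro _ _ (@from_sl2K _ _ he A)) (@to_sl2_ker _ _ he).
exists f; split=> //; rewrite fE; apply: val_inj; apply/matrixP => i j;
  rewrite /= !mxE sgenK /cf !mxE -!val_eqE /= !inordK //=;
  by case: i => -[|[|//]] ?; case: j => -[|[|//]] ? /=; ring.
Qed.
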